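(* Let $p\ge 2$ be an integer. The space of symmetric linear functions of the restricted quantum group $\overline{U}_q=\overline{U}_qsl_2(\mathbb{C})$ at $q=e^{\pi i/p}$ is $(3p-1)$-dimensional over $\mathbb{C}$.
   Context: Let $p\ge 2$ be an integer and $q=e^{\pi i/p}$. The restricted quantum group $\overline{U}_q=\overline{U}_qsl_2(\mathbb{C})$ is the associative unital $\mathbb{C}$-algebra generated by $E,F,K$ with relations $E^p=F^p=0$, $K^{2p}=1$, $KEK^{-1}=q^2E$, $KFK^{-1}=q^{-2}F$, $[E,F]=EF-FE=\frac{K-K^{-1}}{q-q^{-1}}$. A symmetric linear function of a finite-dimensional associative $\mathbb{C}$-algebra $A$ with unity is a linear map $\varphi:A\to\mathbb{C}$ with $\varphi(ab)=\varphi(ba)$ for all $a,b\in A$. *)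

(* Defs.v *)
From HB Require Import structures.
From mathcomp Require Import all_boot all_order all_algebra generic_quotient.
From mathcomp Require Import ring_quotient.
From mathcomp Require Import boolp classical_sets functions reals sequences exp trigo.
From mathcomp Require Import complex.
From mathcomp Require Import finmap monalg.

Set Implicit Arguments.
Unset Strict Implicit.
Unset Printing Implicit Defensive.

Import GRing.Theory Num.Theory.
Import Quotient.

Local Open Scope ring_scope.
Local Open Scope quotient_scope.

(* ring_quotient only provides the ring structure of quotients of commutative
   rings; [twoSidedIdeal] and [alg_quot] cover proper two-sided ideals of
   arbitrary algebras. *)
HB.mixin Record isRightAbsorbing (A : nzRingType) (I : A -> bool) := {
  idealMl_subproof : forall a, {in (I : {pred A}), forall u, u * a \in (I : {pred A})}
}.

#[short(type="twoSidedIdeal")]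
HB.structure Definition TwoSidedIdeal (A : nzRingType) :=
  {I of Idealr A I & isRightAbsorbing A I}.

Lemma idealMl (A : nzRingType) (I : twoSidedIdeal A) a u :
  u \in (I : {pred A}) -> u * a \in (I : {pred A}).
Proof. exact: idealMl_subproof. Qed.

Definition alg_quot (C : comNzRingType) (A : algType C) (I : twoSidedIdeal A) :=
  {quot I}.

Section AlgebraQuotient.
Variables (C : comNzRingType) (A : algType C) (I : twoSidedIdeal A).
Local Notation Q := (alg_quot I).

HB.instance Definition _ : EqQuotient A (equiv I) Q := EqQuotient.on Q.
HB.instance Definition _ := GRing.Zmodule.on Q.
HB.instance Definition _ := ZmodQuotient.on Q.

Definition quot_one : Q := lift_cst Q 1.
Definition quot_mul : Q -> Q -> Q := lift_op2 Q *%R.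
Definition quot_scale (c : C) : Q -> Q := lift_op1 Q ( *:%R c).

Lemma pi_quot_eq (x y : A) : (\pi_Q x == \pi_Q y) = (x - y \in (I : {pred A})).
Proof. by rewrite piE equivE. Qed.

Lemma repr_pi_sub (x : A) : repr (\pi_Q x) - x \in (I : {pred A}).
Proof. by rewrite -pi_quot_eq reprK. Qed.

Lemma pi_quot_mul (x y : A) : \pi_Q (x * y) = quot_mul (\pi_Q x) (\pi_Q y).
Proof.
unlock quot_mul; apply/esym/eqP; rewrite pi_quot_eq.
set x' := repr _; set y' := repr _.
have -> : x' * y' - x * y = x' * (y' - y) + (x' - x) * y.
  by rewrite mulrBr mulrBl addrA subrK.
apply: rpredD; [apply: idealMr|apply: idealMl]; exact: repr_pi_sub.
Qed.

Lemma pi_quot_scale c (x : A) : \pi_Q (c *: x) = quot_scale c (\pi_Q x).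
Proof.
unlock quot_scale; apply/esym/eqP; rewrite pi_quot_eq -scalerBr -mulr_algl.
by rewrite idealMr ?repr_pi_sub.
Qed.

Lemma pi_quot_one : \pi_Q 1 = quot_one.
Proof. by unlock quot_one. Qed.

Lemma quot_mulA : associative quot_mul.
Proof.
by move=> x y z; rewrite -[x]reprK -[y]reprK -[z]reprK -!pi_quot_mul mulrA.
Qed.

Lemma quot_mul1 : left_id quot_one quot_mul.
Proof. by move=> x; rewrite -[x]reprK -pi_quot_one -pi_quot_mul mul1r. Qed.

Lemma quot_mulr1 : right_id quot_one quot_mul.
Proof. by move=> x; rewrite -[x]reprK -pi_quot_one -pi_quot_mul mulr1. Qed.

Lemma quot_mulDl : left_distributive quot_mul +%R.
Proof.
move=> x y z; rewrite -[x]reprK -[y]reprK -[z]reprK.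
by rewrite -!pi_addr -!pi_quot_mul -pi_addr mulrDl.
Qed.

Lemma quot_mulDr : right_distributive quot_mul +%R.
Proof.
move=> x y z; rewrite -[x]reprK -[y]reprK -[z]reprK.
by rewrite -!pi_addr -!pi_quot_mul -pi_addr mulrDr.
Qed.

Lemma quot_one_neq0 : quot_one != 0.
Proof. by rewrite -pi_quot_one -pi_zeror pi_quot_eq subr0 idealr1. Qed.

HB.instance Definition _ := GRing.Zmodule_isNzRing.Build Q
  quot_mulA quot_mul1 quot_mulr1 quot_mulDl quot_mulDr quot_one_neq0.

Lemma quot_scaleA a b x :
  quot_scale a (quot_scale b x) = quot_scale (a * b) x.
Proof. by rewrite -[x]reprK -!pi_quot_scale scalerA. Qed.

Lemma quot_scale1 : left_id 1 quot_scale.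
Proof. by move=> x; rewrite -[x]reprK -pi_quot_scale scale1r. Qed.

Lemma quot_scaleDr : right_distributive quot_scale +%R.
Proof.
move=> c x y; rewrite -[x]reprK -[y]reprK.
by rewrite -pi_addr -!pi_quot_scale -pi_addr scalerDr.
Qed.

Lemma quot_scaleDl x : {morph quot_scale^~ x : a b / a + b}.
Proof.
by move=> a b; rewrite -[x]reprK -!pi_quot_scale -pi_addr scalerDl.
Qed.

HB.instance Definition _ := GRing.Zmodule_isLmodule.Build C Q
  quot_scaleA quot_scale1 quot_scaleDr quot_scaleDl.

Lemma quot_scaleAl (c : C) (x y : Q) : c *: (x * y) = (c *: x) * y.
Proof.
rewrite -[x]reprK -[y]reprK.
change (quot_scale c (quot_mul (\pi_Q (repr x)) (\pi_Q (repr y)))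
  = quot_mul (quot_scale c (\pi_Q (repr x))) (\pi_Q (repr y))).
by rewrite -pi_quot_mul -!pi_quot_scale -pi_quot_mul scalerAl.
Qed.

HB.instance Definition _ := GRing.Lmodule_isLalgebra.Build C Q quot_scaleAl.

Lemma quot_scaleAr (c : C) (x y : Q) : c *: (x * y) = x * (c *: y).
Proof.
rewrite -[x]reprK -[y]reprK.
change (quot_scale c (quot_mul (\pi_Q (repr x)) (\pi_Q (repr y)))
  = quot_mul (\pi_Q (repr x)) (quot_scale c (\pi_Q (repr y)))).
by rewrite -pi_quot_mul -!pi_quot_scale -pi_quot_mul scalerAr.
Qed.

HB.instance Definition _ := GRing.Lalgebra_isAlgebra.Build C Q quot_scaleAr.

End AlgebraQuotient.

Inductive ideal_span (A : nzRingType) (S : A -> Prop) : A -> Prop :=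
| IdealSpanGen x of S x : ideal_span S x
| IdealSpan0 : ideal_span S 0
| IdealSpanD x y of ideal_span S x & ideal_span S y : ideal_span S (x + y)
| IdealSpanMl a x of ideal_span S x : ideal_span S (a * x)
| IdealSpanMr a x of ideal_span S x : ideal_span S (x * a).

(* The free algebra C<E, F, K>: finite C-linear combinations of words in three
   letters. monalg only makes it a left algebra. *)
Definition free_alg3 (C : comNzRingType) : Type := {malg C[{fmonom 'I_3}]}.

Section FreeAlgebra.
Variable C : comNzRingType.

HB.instance Definition _ := GRing.Lalgebra.on (free_alg3 C).

Lemma malg_scaleAr (K : monomType) (c : C) (x y : {malg C[K]}) :
  c *: (x * y) = x * (c *: y).
Proof.
apply/malgP => k; rewrite mcoeffZ mcoeffMl.
rewrite (mcoeffMlw _ (fsubset_refl _) (msuppZ_le _ _)) mulr_sumr.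
apply: eq_bigr => k1 _; rewrite mulr_sumr; apply: eq_bigr => k2 _.
by rewrite mcoeffZ mulrnAr mulrCA.
Qed.

Lemma free_alg3_scaleAr (c : C) (x y : free_alg3 C) :
  c *: (x * y) = x * (c *: y).
Proof. exact: malg_scaleAr. Qed.

HB.instance Definition _ :=
  GRing.Lalgebra_isAlgebra.Build C (free_alg3 C) free_alg3_scaleAr.

End FreeAlgebra.

Section RestrictedQuantumGroup.
Variable R : realType.
Local Notation C := R[i].

Definition cexp (z : C) : C :=
  (expR (complex.Re z))%:C%C
  * (cos (complex.Im z) +i* sin (complex.Im z))%C.

Definition uq_q (p : nat) : C := cexp ((pi : R)%:C%C * 'i / p%:R).

Local Notation FA := (free_alg3 C).

Definition letter (j : 'I_3) : FA := << fmu j >>.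
Definition freeE : FA := letter 0.
Definition freeF : FA := letter 1.
Definition freeK : FA := letter 2.

(* K^-1 is K^(2p-1), because K^(2p) = 1. *)
Definition freeKinv (p : nat) : FA := freeK ^+ (2 * p - 1).

(* The relations r = s, as the differences r - s. *)
Inductive uq_relator (p : nat) : FA -> Prop :=
| RelEp : uq_relator p (freeE ^+ p)
| RelFp : uq_relator p (freeF ^+ p)
| RelK2p : uq_relator p (freeK ^+ (2 * p) - 1)
| RelKE : uq_relator p
    (freeK * freeE * freeKinv p - (uq_q p ^+ 2) *: freeE)
| RelKF : uq_relator p
    (freeK * freeF * freeKinv p - (uq_q p ^- 2) *: freeF)
| RelEF : uq_relator p
    ((freeE * freeF - freeF * freeE)
      - (uq_q p - (uq_q p)^-1)^-1 *: (freeK - freeKinv p)).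

(* The ideal is proper for p > 0 only, so that the hypothesis on p is carried
   along to make the quotient a (nonzero) ring. *)
Definition uq_ideal (p : nat) (hp : (2 <= p)%N) : FA -> bool :=
  fun x => `[< ideal_span (uq_relator p) x >].

Section Ideal.
Variables (p : nat) (hp : (2 <= p)%N).

(* The trivial representation E, F |-> 0, K |-> 1 shows that the ideal is
   proper. *)
Definition counit_word (w : {fmonom 'I_3}) : C :=
  (all (pred1 (2 : 'I_3)) (w : seq 'I_3))%:R.

Lemma counit_word_morphism : mmorphism counit_word.
Proof.
split=> [x y|]; last by rewrite /counit_word fm1.
by rewrite /counit_word fmM all_cat; case: all; rewrite ?mul1r ?mul0r.
Qed.

HB.instance Definition _ :=
  isMultiplicative.Build _ _ counit_word counit_word_morphism.

Definition counit (x : {malg C[{fmonom 'I_3}]}) : C := mmap idfun counit_word x.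

Lemma counit_letter j : counit (letter j) = (j == 2)%:R.
Proof. by rewrite /counit /letter mmapU /= /counit_word fmU /= andbT mul1r. Qed.

Lemma counitM (x y : FA) : counit (x * y) = counit x * counit y.
Proof. exact: rmorphM. Qed.

Lemma counitB (x y : FA) : counit (x - y) = counit x - counit y.
Proof. exact: rmorphB. Qed.

Lemma counitD (x y : FA) : counit (x + y) = counit x + counit y.
Proof. exact: rmorphD. Qed.

Lemma counitX (x : FA) n : counit (x ^+ n) = counit x ^+ n.
Proof. exact: rmorphXn. Qed.

Lemma counitZ c (x : FA) : counit (c *: x) = c * counit x.
Proof. exact: mmapZ. Qed.

Lemma counit1 : counit (1 : FA) = 1.
Proof. exact: rmorph1. Qed.

Lemma counit_ideal x : x \in (uq_ideal hp : {pred FA}) -> counit x = 0.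
Proof.
move/asboolP; elim=> {x}.
- have [E0 F0 K1] : [/\ counit freeE = 0, counit freeF = 0 & counit freeK = 1].
    by rewrite !counit_letter.
  have EX n : (0 < n)%N -> counit (freeE ^+ n) = 0.
    by move=> n0; rewrite counitX E0 expr0n eqn0Ngt n0.
  have FX n : (0 < n)%N -> counit (freeF ^+ n) = 0.
    by move=> n0; rewrite counitX F0 expr0n eqn0Ngt n0.
  have KX n : counit (freeK ^+ n) = 1 by rewrite counitX K1 expr1n.
  move=> r rel; case: r / rel; rewrite /freeKinv; move: (uq_q p) => q;
    move: E0 F0 K1 EX FX KX; move: freeE freeF freeK => E F K E0 F0 K1 EX FX KX.
  + by apply: EX; exact: ltnW.
  + by apply: FX; exact: ltnW.
  + by rewrite counitB KX counit1 subrr.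
  + by rewrite counitB !counitM counitZ K1 KX E0 mulr1 !mulr0 subrr.
  + by rewrite counitB !counitM counitZ K1 KX F0 mulr1 !mulr0 subrr.
  + move: (_^-1) => c; move: (KX (2 * p - 1)%N); move: (K ^+ _) => K' K'1.
    have EF0 : counit (E * F) = 0 by rewrite (counitM E F) E0 mul0r.
    have FE0 : counit (F * E) = 0 by rewrite (counitM F E) E0 mulr0.
    have KK0 : counit (K - K') = 0 by rewrite (counitB K K') K1 K'1 subrr.
    apply: etrans (counitB _ _) _; apply/eqP; rewrite subr_eq0; apply/eqP.
  apply: (@etrans _ _ 0).
      exact: etrans (counitB _ _)
        (etrans (congr2 (fun a b => a - b) EF0 FE0) (subrr 0)).
    by apply/esym; apply: etrans (counitZ _ _) _; rewrite KK0 mulr0.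
- exact: rmorph0.
- by move=> x y _ x0 _ y0; rewrite counitD x0 y0 addr0.
- by move=> a x _ x0; rewrite counitM x0 mulr0.
- by move=> a x _ x0; rewrite counitM x0 mul0r.
Qed.

Lemma uq_ideal_closed : idealr_closed (uq_ideal hp : {pred FA}).
Proof.
split.
- exact/asboolP/IdealSpan0.
- by apply/negP => /counit_ideal /eqP; rewrite counit1 oner_eq0.
- move=> a x y /asboolP x0 /asboolP y0; apply/asboolP.
  by apply: IdealSpanD => //; apply: IdealSpanMl.
Qed.

Lemma uq_idealMl a : {in (uq_ideal hp : {pred FA}), forall u,
  u * a \in (uq_ideal hp : {pred FA})}.
Proof. by move=> u /asboolP u0; apply/asboolP/IdealSpanMr. Qed.

HB.instance Definition _ := isIdealr.Build FA (uq_ideal hp) uq_ideal_closed.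
HB.instance Definition _ :=
  isRightAbsorbing.Build FA (uq_ideal hp) uq_idealMl.

End Ideal.

Definition restricted_Uq (p : nat) (hp : (2 <= p)%N) : algType C :=
  alg_quot (uq_ideal hp).

End RestrictedQuantumGroup.

Section SymmetricLinearFunctions.
Variables (C : comNzRingType) (A : algType C).

Definition symmetric_linear (phi : A -> C^o) : bool :=
  `[< linear phi /\ forall a b, phi (a * b) = phi (b * a) >].

Lemma symmetric_linear_submod :
  submod_closed (symmetric_linear : {pred A -> C^o}).
Proof.
split.
  apply/asboolP; split=> // c x y.
  by change (0 = c *: 0 + 0 :> C^o); rewrite scaler0 addr0.
move=> c f g /asboolP[fl fs] /asboolP[gl gs]; apply/asboolP; split.
  move=> d x y.
  change (c *: f (d *: x + y) + g (d *: x + y)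
    = d *: (c *: f x + g x) + (c *: f y + g y)).
  by rewrite fl gl !scalerDr !scalerA (mulrC d c) addrACA.
move=> a b.
by change (c *: f (a * b) + g (a * b) = c *: f (b * a) + g (b * a));
  rewrite fs gs.
Qed.

HB.instance Definition _ :=
  GRing.isSubmodClosed.Build C (A -> C^o) symmetric_linear
    symmetric_linear_submod.

Record slf := Slf {
  slf_fun :> A -> C^o;
  slfP : slf_fun \in (symmetric_linear : {pred A -> C^o})
}.

HB.instance Definition _ := [isSub for slf_fun].
HB.instance Definition _ := [Choice of slf by <:].
HB.instance Definition _ := [SubChoice_isSubLmodule of slf by <:].

End SymmetricLinearFunctions.

(* Main.v *)
Require Import Defs.
From HB Require Import structures.
From mathcomp Require Import all_boot all_order all_algebra generic_quotient.
From mathcomp Require Import ring_quotient boolp reals exp trigo complex.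
From mathcomp Require Import finmap monalg.
From mathcomp Require Import zify ring.

(* Let [e_j] ([j] modulo [2p]) be the projectors onto the eigenvalues [q^j] of
   [K], let [C] be the Casimir element and [gam s] the value for which
   [F E e_j = (C - gam (j + 1)) e_j] and [E F e_j = (C - gam (j - 1)) e_j].
   Commuting with [K] shows that a symmetric linear function is determined by
   the functionals [phi_j g = phi (g(C) e_j)] on polynomials.  The relations
   [E^p = F^p = 0] say that [phi_j] kills the product [turn j] of the
   [X - gam s] over the [s] of the parity opposite to [j], and symmetry says
   that [phi_j - phi_(j-2)] is a multiple [c_(j-1)] of the evaluation at
   [gam (j - 1)].  The [gam s] satisfy [gam (- s) = gam s] and are otherwise
   distinct, so the [c_s] around the circle are subject only to
   [c_(- s) = - c_s].  Hence [phi_0] and [phi_1] ([p] parameters each) and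
   [c_1, ..., c_(p-1)] are free coordinates.

   Conversely a family [phi_j] defines a cyclic functional on words in [E], [F],
   [K]: a word of total degree [0] is read as a closed path of weights starting
   at each [j], with a factor [X - gam (s + 1)] for each step from [s] up to
   [s + 2], and the values of [phi_j] on these polynomials are summed.  It kills
   the relators, so that no basis of the algebra is needed. *)

Set Implicit Arguments.
Unset Strict Implicit.
Unset Printing Implicit Defensive.

Import Order.TTheory GRing.Theory Num.Theory.
Local Open Scope ring_scope.

(** * The parameter q *)

Section RootOfUnity.
Variable R : realType.

Lemma cos_sin_exp (t : R) n :
  (cos t +i* sin t)%C ^+ n = (cos (t *+ n) +i* sin (t *+ n))%C.
Proof.
elim: n => [|n IH]; first by rewrite expr0 mulr0n cos0 sin0.
rewrite exprS IH mulrS cosD sinD; apply/eqP; rewrite eq_complex /=.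
by apply/andP; split; apply/eqP; ring.
Qed.

Lemma uq_qE p : uq_q R p = (cos (pi / p%:R) +i* sin (pi / p%:R))%C.
Proof.
rewrite /uq_q /cexp.
have -> : ((pi : R)%:C%C * 'i / p%:R) = (0 +i* (pi / p%:R))%C.
  rewrite -complexiE -(rmorph_nat (real_complex R)) -fmorphV.
  by apply/eqP; rewrite eq_complex /=; apply/andP; split; apply/eqP; ring.
by rewrite /= expR0 mul1r.
Qed.

(** For [0 < i < 2p] half the angle of [q ^+ i] lies strictly between [0] and [pi], where the sine
    is positive, so that [cos (2t) = 1 - 2 sin^2 t] cannot be [1]. *)
Lemma uq_q_prim p : (0 < p)%N -> (2 * p).-primitive_root (uq_q R p).
Proof.
move=> p0; have p0' : (0 : R) < p%:R by rewrite ltr0n.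
have pip : pi / p%:R *+ (2 * p) = pi *+ 2 :> R.
  by rewrite mulnC mulrnA -(mulr_natr (pi / _) p) divfK ?gt_eqF.
rewrite /primitive_root_of_unity; apply/andP; split; first by lia.
apply/forallP => -[i /= ilt]; apply/eqP; rewrite unity_rootE uq_qE cos_sin_exp.
have [->|neq] := eqVneq i.+1 (2 * p)%N.
  by rewrite pip cos2pi sin2pi; apply/eqP.
apply/negP => /eqP [c1 _].
pose t : R := pi / p%:R *+ i.+1 / 2.
have tE : pi / p%:R *+ i.+1 = t *+ 2 
  by rewrite /t -(mulr_natr (_ / 2)) divfK ?pnatr_eq0.
have t0 : 0 < t by rewrite divr_gt0 // pmulrn_rgt0 // divr_gt0 // pi_gt0.
have tpi : t < pi.
  rewrite /t ltr_pdivrMr // mulr_natr -pip ltr_pMn2l; first by lia.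
  by rewrite divr_gt0 // pi_gt0.
have := sin_gt0_pi (x := t); rewrite t0 tpi => /(_ isT) s0.
move: c1; rewrite tE cos_mulr2n cos2sin2 => /eqP.
rewrite -subr_eq0 => /eqP c1.
have /eqP : sin t ^+ 2 *+ 2 = 0 by rewrite -[RHS]oppr0 -c1; ring.
by rewrite mulrn_eq0 /= sqrf_eq0 gt_eqF.
Qed.

End RootOfUnity.

(** * Families of functionals on the Casimir variable *)

Lemma sum_ord_shift (V : zmodType) (n : nat) (h : nat -> V) :
  h n = h 0%N -> \sum_(j < n) h j.+1 = \sum_(j < n) h j.
Proof.
case: n => [|n] hn; first by rewrite !big_ord0.
by rewrite big_ord_recr big_ord_recl /= addrC hn.
Qed.

Lemma sum_shift2 (V : zmodType) (p : nat) (h : int -> V) :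
  (forall j, h (j + (2 * p)%N%:Z) = h j) ->
  \sum_(j < 2 * p) h (j%:Z + 2) = \sum_(j < 2 * p) h j%:Z.
Proof.
move=> hper; rewrite -(@sum_ord_shift _ _ (fun j => h j%:Z)); last first.
  by rewrite -(hper 0) add0r.
rewrite -(@sum_ord_shift _ _ (fun j => h j.+1%:Z)); last first.
  by rewrite -(hper 1); congr h; lia.
by apply: eq_bigr => j _; congr h; lia.
Qed.

Section CasimirValues.
Variables (k : fieldType) (p : nat) (q : k).
Hypotheses (p_gt1 : (1 < p)%N) (q_prim : (2 * p).-primitive_root q).

Let M := (2 * p)%N.

Lemma qroot_neq0 : q != 0.
Proof.
apply/eqP => q0; have := prim_expr_order q_prim.
rewrite q0 expr0n eqn0Ngt (prim_order_gt0 q_prim) => /eqP.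
by rewrite eq_sym oner_eq0.
Qed.

Lemma qroot_dvd (s : int) : (q ^ s == 1) = (M%:Z %| s)%Z.
Proof.
rewrite dvdzE absz_nat (prim_order_dvd q_prim).
by case: s => n //=; rewrite /exprz /= invr_eq1.
Qed.

Lemma qrootD2p s : q ^ (s + M%:Z) = q ^ s.
Proof.
rewrite expfzDr ?qroot_neq0 //; have /eqP -> : q ^ M%:Z == 1 by rewrite qroot_dvd.
by rewrite mulr1.
Qed.

Lemma qrootX2p (s : int) : (q ^ s) ^+ (2 * p) = 1.
Proof. by rewrite exprnP exprz_exp; apply/eqP; rewrite qroot_dvd dvdz_mull. Qed.

(** The eigenvalue on weight [s] of [K ^+ (2 * p - 1)], which stands for the inverse of [K]. *)
Lemma qrootX2pB1 (s : int) : (q ^ s) ^+ (2 * p - 1) = q ^ (- s).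
Proof.
rewrite -invr_expz; apply: (mulIf (expfz_neq0 s qroot_neq0)).
rewrite mulVf ?expfz_neq0 ?qroot_neq0 // -exprSr.
have -> : (2 * p - 1).+1 = (2 * p)%N by lia.
exact: qrootX2p.
Qed.

(** A geometric series: orthogonality of the characters of the integers modulo [2p], on which the
    projectors [idem] rest. *)
Lemma qroot_sum (s : int) :
  \sum_(m < 2 * p) q ^ (s * m%:Z) = if (M%:Z %| s)%Z then M%:R else 0.
Proof.
rewrite -qroot_dvd (eq_bigr (fun m : 'I_M => (q ^ s) ^+ m)) => [|m _]; last first.
  by rewrite exprnP exprz_exp.
case: eqP => [->|/eqP qs1].
  under eq_bigr do rewrite expr1n.
  by rewrite sumr_const card_ord.
have := subrX1 (q ^ s) M; rewrite qrootX2p subrr => /esym /eqP.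
by rewrite mulf_eq0 subr_eq0 (negPf qs1) => /eqP.
Qed.

Lemma natM_neq0 : M%:R != 0 :> k.
Proof. exact: prim_root_natf_neq0 q_prim. Qed.

Lemma qroot_inv_neq0 : q - q^-1 != 0.
Proof.
rewrite subr_eq0; apply/negP => /eqP qV.
have : q ^+ 2 == 1 by rewrite expr2 {1}qV mulVf // qroot_neq0.
by rewrite -(prim_order_dvd q_prim) => /dvdn_leq => /(_ isT); lia.
Qed.

Definition gam (s : int) : k := (q ^ s + q ^ (- s)) / (q - q^-1) ^+ 2.

Lemma gamN s : gam (- s) = gam s.
Proof. by rewrite /gam opprK addrC. Qed.

Lemma gamD2p s : gam (s + M%:Z) = gam s.
Proof. by rewrite /gam -!invr_expz qrootD2p. Qed.

Lemma gam_modz s t : (M%:Z %| s - t)%Z -> gam s = gam t.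
Proof.
rewrite -qroot_dvd => /eqP qst.
have -> : s = (s - t) + t by lia.
by rewrite /gam -!invr_expz expfzDr ?qroot_neq0 // qst mul1r.
Qed.

(** With [x = q ^ s] and [y = q ^ t], the difference of [x + 1/x] and [y + 1/y] is, up to the unit
    [x], the product [(x / y - 1) * (x * y - 1)]. *)
Lemma gam_inj s t : gam s = gam t -> (M%:Z %| s - t)%Z || (M%:Z %| s + t)%Z.
Proof.
move/(mulIf _) => /(_ (invr_neq0 (expf_neq0 2 qroot_inv_neq0))).
rewrite -!invr_expz => eq_st; rewrite -!qroot_dvd.
have qN0 : q != 0 := qroot_neq0.
have [s0 t0] : q ^ s != 0 /\ q ^ t != 0 by split; apply: expfz_neq0.
rewrite !expfzDr // -invr_expz; set x := q ^ s in eq_st s0 *.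
set y := q ^ t in eq_st t0 *.
have : (x / y - 1) * (x * y - 1) == 0.
  have -> : (x / y - 1) * (x * y - 1) = x * ((x + x^-1) - (y + y^-1)).
    by field; rewrite s0 t0.
  by rewrite eq_st subrr mulr0.
by rewrite mulf_eq0 !subr_eq0.
Qed.

(** The right side is the scalar by which [[E, F]] acts on weight [s]; this is why one Casimir
    variable serves both [E F] and [F E]. *)
Lemma gam_step s :
  gam (s + 1) - gam (s - 1) = (q - q^-1)^-1 * (q ^ s - q ^ (- s)).
Proof.
rewrite /gam !opprD opprK !expfzDr ?qroot_neq0 // expr1z.
have -> : q ^ (- 1) = q^-1 by [].
field; have q0 := qroot_neq0; rewrite q0 /=.
apply: contraNneq qroot_inv_neq0 => qq.
by rewrite -(mulfK q0 (q - _)) mulrBl mulVf // qq mul0r.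
Qed.

Definition edge (s : int) : {poly k} := 'X - (gam s)%:P.

Lemma edgeD2p s : edge (s + M%:Z) = edge s.
Proof. by rewrite /edge gamD2p. Qed.

(** The polynomial in the Casimir element by which [F ^+ n * E ^+ n] acts on weight [s]; see
    [climb_idem]. *)
Definition climb (s : int) (n : nat) : {poly k} :=
  \prod_(i < n) edge (s + (2 * i)%N%:Z + 1).

Lemma climbS s n : climb s n.+1 = climb s n * edge (s + (2 * n)%N%:Z + 1).
Proof. by rewrite /climb big_ord_recr. Qed.

Lemma climbSl s n : climb s n.+1 = edge (s + 1) * climb (s + 2) n.
Proof.
rewrite /climb big_ord_recl; congr (_ * _); first by rewrite muln0 addr0.
by apply: eq_bigr => i _; congr edge; rewrite lift0; lia.
Qed.

Lemma climb_monic s n : climb s n \is monic.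
Proof. by apply: monic_prod => i _; apply: monicXsubC. Qed.

Lemma size_climb s n : size (climb s n) = n.+1.
Proof. by rewrite /climb size_prod_XsubC /index_enum -enumT size_enum_ord. Qed.

Definition turn (s : int) := climb s p.

(** [climb s p.+1] splits off either its lowest or its highest edge. These agree by periodicity, and
    the common monic factor cancels. *)
Lemma turnD2 s : turn (s + 2) = turn s.
Proof.
apply: (mulfI (monic_neq0 (monicXsubC (gam (s + 1))))).
rewrite -/(edge _) /turn -climbSl climbS mulrC; congr (_ * _).
by rewrite -(edgeD2p (s + 1)); congr edge; rewrite /M; lia.
Qed.

Lemma turn_congr s t : (2 %| s - t)%Z -> turn s = turn t.
Proof.
move=> /dvdzP [c st]; have -> : s = t + c * 2 by lia.
elim/int_ind: c {st} => [|n IH|n IH]; first by rewrite mul0r addr0.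
  by rewrite -IH -[RHS]turnD2; congr turn; lia.
by rewrite -IH -turnD2; congr turn; lia.
Qed.

(** Only the parity of [s] matters for [turn s], so the circuit may start at [t - 1], where its
    first factor is [edge t]. *)
Lemma turn_root s t : ~~ (2 %| s - t)%Z -> (turn s).[gam t] = 0.
Proof.
move=> st; rewrite (@turn_congr s (t - 1)); last by lia.
rewrite /turn; case: p p_gt1 => // n _; rewrite climbSl hornerM subrK.
by rewrite hornerXsubC subrr mul0r.
Qed.

(* [phi j g] stands for the value of a symmetric linear function at
   [g(C) e_j], where [C] is the Casimir element and [e_j] the projector onto
   the eigenvalue [q ^ j] of [K]. *)
Definition weight_family (phi : int -> {poly k} -> k) : Prop :=
  [/\ forall j b f g, phi j (b *: f + g) = b * phi j f + phi j g,
      forall j, phi (j + M%:Z) =1 phi j,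
      forall j g, phi j (edge (j - 1) * g) = phi (j - 2) (edge (j - 1) * g)
    & forall j g, phi j (turn j * g) = 0].

End CasimirValues.

(** * Vanishing of a weight family from its coordinates *)

Section WeightFamily.
Variables (k : fieldType) (p : nat) (q : k).
Hypotheses (p_gt1 : (1 < p)%N) (q_prim : (2 * p).-primitive_root q).
Variable phi : int -> {poly k} -> k.
Hypothesis phiP : weight_family p q phi.
Local Notation edge := (edge q).
Local Notation turn := (turn p q).
Local Notation gam := (gam q).

Lemma weight_family_lin j b f g : phi j (b *: f + g) = b * phi j f + phi j g.
Proof. by case: phiP. Qed.

Lemma weight_family_per j f : phi (j + (2 * p)%N%:Z) f = phi j f.
Proof. by case: phiP => _ ->. Qed.

Lemma weight_family_edge j g :
  phi j (edge (j - 1) * g) = phi (j - 2) (edge (j - 1) * g).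
Proof. by case: phiP. Qed.

Lemma weight_family_turn j g : phi j (turn j * g) = 0.
Proof. by case: phiP. Qed.

Lemma weight_family0 j : phi j 0 = 0.
Proof.
by have := weight_family_lin j (-1) 0 0; rewrite scaler0 addr0 mulN1r addNr.
Qed.

Lemma weight_familyZ j b f : phi j (b *: f) = b * phi j f.
Proof. by rewrite -[b *: f]addr0 weight_family_lin weight_family0 addr0. Qed.

Lemma weight_familyD j f g : phi j (f + g) = phi j f + phi j g.
Proof. by rewrite -[f]scale1r weight_family_lin mul1r scale1r. Qed.

Lemma weight_familyB j f g : phi j (f - g) = phi j f - phi j g.
Proof. by rewrite addrC -scaleN1r weight_family_lin mulN1r addrC. Qed.

Lemma weight_family_mod j : phi j =1 phi (j %% (2 * p)%N)%Z.
Proof.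
move=> g; rewrite {1}(divz_eq j (2 * p)%N) addrC.
move: (_ %/ _)%Z (_ %% _)%Z => d r.
elim/int_ind: d => [|n IH|n IH]; first by rewrite mul0r addr0.
  by rewrite -IH -[RHS]weight_family_per; congr (phi _ g); lia.
by rewrite -IH -[LHS]weight_family_per; congr (phi _ g); lia.
Qed.

(** Division by [turn j], of degree [p], leaves a remainder spanned by the tested monomials. *)
Lemma weight_family_base j :
  (forall i, (i < p)%N -> phi j 'X^i = 0) -> phi j =1 fun=> 0.
Proof.
move=> phiX g; rewrite (divp_eq g (turn j)) weight_familyD mulrC.
rewrite weight_family_turn add0r -[X in phi j X]coefK poly_def.
have : (size (g %% turn j)%R <= p)%N.
  by rewrite -ltnS -(size_climb q j p) ltn_modp monic_neq0 ?climb_monic.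
move: (g %% turn j) => h; elim: (size h) => [|n IH] lt_np.
  by rewrite big_ord0 weight_family0.
rewrite big_ord_recr /= weight_familyD weight_familyZ phiX // mulr0 addr0.
by apply: IH; apply: ltnW.
Qed.

Let jump (s : int) := phi (s + 1) 1 - phi (s - 1) 1.

(** The difference kills the multiples of [edge s], hence factors through evaluation at [gam s]. *)
Lemma weight_family_jump s g :
  phi (s + 1) g - phi (s - 1) g = jump s * g.[gam s].
Proof.
have /factor_theorem [h gE] : root (g - g.[gam s]%:P) (gam s).
  by rewrite rootE hornerD hornerN hornerC subrr.
have -> : g = edge s * h + g.[gam s] *: 1 by rewrite alg_polyC mulrC -gE subrK.
have edge_s : phi (s + 1) (edge s * h) = phi (s - 1) (edge s * h).
  have := weight_family_edge (s + 1) h; rewrite addrK.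
  by have -> : s + 1 - 2 = s - 1 by lia.
rewrite !weight_familyD !weight_familyZ edge_s opprD addrACA subrr add0r -mulrBr.
rewrite hornerD hornerM hornerXsubC subrr mul0r add0r alg_polyC hornerC.
exact: mulrC.
Qed.

(** The differences of [weight_family_jump] cancel around the circle of weights. *)
Lemma sum_jump g : \sum_(s < 2 * p) jump s%:Z * g.[gam s%:Z] = 0.
Proof.
under eq_bigr do rewrite -weight_family_jump.
rewrite sumrB; apply/eqP; rewrite subr_eq0; apply/eqP.
rewrite -[RHS](@sum_shift2 _ p (fun j => phi (j - 1) g)) => [|j].
  by apply: eq_bigr => j _; congr (phi _ g); lia.
by rewrite addrAC weight_family_per.
Qed.

(** First all jumps vanish: those with [0 < s < p] by assumption, the others because their values
    [gam s] are pairwise distinct and [sum_jump] separates them. The vanishing then spreads from the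
    weights [0] and [1]. *)
Lemma weight_family_eq0 :
  (forall i, (i < p)%N -> phi 0 'X^i = 0) ->
  (forall i, (i < p)%N -> phi 1 'X^i = 0) ->
  (forall s : nat, (0 < s < p)%N -> phi (s%:Z + 1) 1 = phi (s%:Z - 1) 1) ->
  forall j g, phi j g = 0.
Proof.
move=> phi0 phi1 phis.
have jump0 (s : 'I_(2 * p)) : jump s = 0.
  have [sp|sp] := boolP (0 < s < p)%N; first by rewrite /jump phis // subrr.
  (* A test polynomial vanishing at the other values of [gam] isolates jump [s]. *)
  pose P (u : 'I_(2 * p)) := (u != s) && ~~ (0 < u < p)%N.
  have := sum_jump (\prod_(u | P u) edge u%:Z).
  rewrite (bigD1 s) //= [X in _ + X]big1 ?addr0 => [/eqP|u us].
    rewrite mulf_eq0 => /orP [/eqP //|]; rewrite horner_prod prodf_seq_eq0.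
    (* A root at [gam s] would make [2p] divide [u - s] or [u + s], impossible for distinct indices
       outside the open interval from [0] to [p]. *)
    case/hasP => u _ /andP[/andP [us up]].
    rewrite hornerXsubC subr_eq0 => /eqP /(gam_inj p_gt1 q_prim).
    have {}us : nat_of_ord u <> s by move=> eq_us; case/eqP: us; apply/val_inj.
    move: us up sp (ltn_ord u) (ltn_ord s).
    move: (nat_of_ord u) (nat_of_ord s) => x y {}us {}up {}sp xM yM.
    case/orP => /dvdzP [d].
      have [->|[d1|d1]] : d = 0 \/ d <= -1 \/ 1 <= d by lia.
      - by lia.
      - by nia.
      - by nia.
    have [->|[d1|[->|d1]]] : d = 1 \/ d <= -1 \/ d = 0 \/ 2 <= d by lia.
    - by lia.
    - by nia.
    - by lia.
    - by nia.
  have [up|up] := boolP (0 < u < p)%N; first by rewrite /jump phis // subrr mul0r.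
  rewrite horner_prod (bigD1 u) /=; last by rewrite /P us.
  by rewrite hornerXsubC subrr mul0r mulr0.
(* The functionals at [n] and [n + 2] differ by the jump at [n + 1], so the induction runs in steps
   of two within each parity. *)
have phi_nat (n : nat) : (n < 2 * p)%N -> phi n =1 fun=> 0.
  elim/ltn_ind: n => -[|[|n]] IH lt_n g; first exact: weight_family_base.
    exact: weight_family_base.
  have lt_n1 : (n.+1 < 2 * p)%N by lia.
  have /eqP := weight_family_jump n.+1%:Z g.
  rewrite (jump0 (Ordinal lt_n1)) mul0r subr_eq0 => /eqP.
  have -> : n.+1%:Z - 1 = n%:Z by lia.
  have -> : n.+1%:Z + 1 = n.+2%:Z by lia.
  by move=> ->; apply: IH; lia.
move=> j g; rewrite weight_family_mod.
have M0 : (2 * p)%N%:Z != 0 by lia.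
have r0 := modz_ge0 j M0; have rlt := ltz_mod j M0.
by rewrite -(gez0_abs r0) phi_nat //; lia.
Qed.

End WeightFamily.

(** * Words as weight paths *)

Section WeightPaths.
Variables (k : fieldType) (p : nat) (q : k).
Local Notation edge := (edge q).
Local Notation climb := (climb q).
Local Notation turn := (turn p q).

Local Notation letE := (0 : 'I_3).
Local Notation letF := (1 : 'I_3).
Local Notation letK := (2 : 'I_3).

Lemma letterP (P : 'I_3 -> Prop) : P letE -> P letF -> P letK -> forall l, P l.
Proof.
move=> PE PF PK [[|[|[|//]]] lt_l].
- by rewrite (_ : Ordinal _ = letE) //; apply/val_inj.
- by rewrite (_ : Ordinal _ = letF) //; apply/val_inj.
- by rewrite (_ : Ordinal _ = letK) //; apply/val_inj.
Qed.

Definition ldeg (l : 'I_3) : int :=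
  if val l is 0%N then 1 else if val l is 1%N then -1 else 0.

Definition wdeg (w : seq 'I_3) : int := \sum_(l <- w) ldeg l.

(* Reading a word from right to left, the weight starts at [s] and each E
   (resp. F) raises (lowers) it by 2. *)
Definition lpoly (s : int) (l : 'I_3) : {poly k} :=
  if val l is 0%N then edge (s + 1) else if val l is 1%N then 1 else (q ^ s)%:P.

Fixpoint wpoly (s : int) (w : seq 'I_3) : {poly k} :=
  if w is l :: w' then lpoly (s + 2 * wdeg w') l * wpoly s w' else 1.

Lemma wdeg_cons l w : wdeg (l :: w) = ldeg l + wdeg w.
Proof. exact: big_cons. Qed.

Lemma wdeg_cat u w : wdeg (u ++ w) = wdeg u + wdeg w.
Proof. exact: big_cat. Qed.

Lemma wdeg_nil : wdeg [::] = 0.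
Proof. exact: big_nil. Qed.

Lemma wdeg_nseq n l : wdeg (nseq n l) = ldeg l * n%:Z.
Proof. by elim: n => [|n IH]; rewrite ?wdeg_nil ?wdeg_cons ?IH; lia. Qed.

Lemma wpoly_cat s u w : wpoly s (u ++ w) = wpoly (s + 2 * wdeg w) u * wpoly s w.
Proof.
elim: u => [|l u IH] /=; first by rewrite mul1r.
rewrite IH mulrA wdeg_cat; congr (lpoly _ _ * _ * _); lia.
Qed.

Lemma wpoly_nseqE s n : wpoly s (nseq n letE) = climb s n.
Proof.
elim: n => [|n IH]; first by rewrite /climb big_ord0.
rewrite climbS /= IH mulrC wdeg_nseq /lpoly /=; congr (_ * edge _).
by rewrite /ldeg /=; lia.
Qed.

Lemma wpoly_nseqK s n : wpoly s (nseq n letK) = ((q ^ s) ^+ n)%:P.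
Proof.
elim: n => [|n IH] /=; first by rewrite expr0 polyC1.
rewrite IH wdeg_nseq /lpoly /= exprS polyCM.
by congr ((q ^ _)%:P * _); rewrite /ldeg /=; lia.
Qed.

(* A path of total degree [n >= 0] must climb through each of the [n] edges
   above its starting weight. *)
Lemma climb_dvd_wpoly s w n : wdeg w = n%:Z -> climb s n %| wpoly s w.
Proof.
elim: w n => [|l w IH] n.
  by rewrite wdeg_nil; case: n => // _; rewrite /climb big_ord0.
rewrite wdeg_cons; elim/letterP: l => /=; rewrite /ldeg /= => degw.
- case: n degw => [|n] degw; first by rewrite /climb big_ord0 dvd1p.
  rewrite climbS mulrC dvdp_mul //; last by apply: IH; lia.
  have -> : wdeg w = n%:Z by lia.
  by rewrite /lpoly /=; have -> : s + (2 * n)%N%:Z = s + 2 * n%:Z by lia.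
- rewrite mul1r; apply: dvdp_trans (IH n.+1 _); last by lia.
  by rewrite climbS dvdp_mulr.
- by apply/dvdp_mull/IH; lia.
Qed.

(** Closedness is measured in the integers: a word whose degree is a nonzero multiple of [p] gets
    [0], although it returns to [s] modulo [2p]. *)
Definition loop (s : int) (w : seq 'I_3) : {poly k} :=
  if wdeg w == 0 then wpoly s w else 0.

(** A closed suffix is read first and returns to [s], so it splits off. This gives right
    multiplication by [K] and [F E], hence by the Casimir element and the projectors. *)
Lemma loop_cat s w u : wdeg u = 0 -> loop s (w ++ u) = loop s w * wpoly s u.
Proof.
move=> degu; rewrite /loop wdeg_cat degu addr0 wpoly_cat degu mulr0 addr0.
by case: eqP => _; rewrite ?mul0r.
Qed.

Lemma loop_catK s w : loop s (w ++ [:: letK]) = loop s w * (q ^ s)%:P.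
Proof.
have degK : wdeg [:: letK] = 0 by rewrite wdeg_cons wdeg_nil.
by rewrite loop_cat //= wdeg_nil mulr0 addr0 mulr1.
Qed.

Lemma loop_catFE s w : loop s (w ++ [:: letF; letE]) = loop s w * edge (s + 1).
Proof.
have degFE : wdeg [:: letF; letE] = 0 by rewrite !wdeg_cons wdeg_nil.
by rewrite loop_cat //= wdeg_nil mulr0 addr0 mulr1 mul1r.
Qed.

Hypotheses (p_gt1 : (1 < p)%N) (q_prim : (2 * p).-primitive_root q).
Variable phi : int -> {poly k} -> k.
Hypothesis phiP : weight_family p q phi.
Let phi_per := weight_family_per phiP.
Let phi_edge := weight_family_edge phiP.
Let phi_turn := weight_family_turn phiP.
Let phi0 := weight_family0 phiP.
Let phiZ := weight_familyZ phiP.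
Let phiB := weight_familyB phiP.

Lemma phi_turn_dvd j f : turn j %| f -> phi j f = 0.
Proof. by move=> /dvdpP [g ->]; rewrite mulrC phi_turn. Qed.


Definition wtrace (w : seq 'I_3) : k := \sum_(j < 2 * p) phi j%:Z (loop j%:Z w).

Lemma lpolyD2p s l : lpoly (s + (2 * p)%N%:Z) l = lpoly s l.
Proof.
elim/letterP: l; rewrite /lpoly //=; last by rewrite qrootD2p.
by rewrite addrAC edgeD2p.
Qed.

Lemma wpolyD2p s w : wpoly (s + (2 * p)%N%:Z) w = wpoly s w.
Proof. by elim: w => //= l w ->; rewrite addrAC lpolyD2p. Qed.

(** Rotation moves the base point of a closed path by one letter. The functionals at the old and the
    new base point agree on the path polynomial because it contains the edge between them. *)
Lemma wtrace_rot1 l w : wtrace (l :: w) = wtrace (w ++ [:: l]).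
Proof.
rewrite /wtrace /loop wdeg_cat wdeg_cons [wdeg [:: l]]wdeg_cons wdeg_nil addr0.
rewrite addrC; case: eqP => [degw|]; last by [].
have dw : wdeg w = - ldeg l by lia.
rewrite (eq_bigr (fun j : 'I_(2 * p) =>
  phi j (lpoly (j%:Z - 2 * ldeg l) l * wpoly j w))); last first.
  by move=> j _ /=; rewrite dw mulrN.
rewrite [RHS](eq_bigr (fun j : 'I_(2 * p) =>
  phi j (wpoly (j%:Z + 2 * ldeg l) w * lpoly j l))); last first.
  move=> j _; rewrite wpoly_cat wdeg_cons wdeg_nil addr0 /= wdeg_nil mulr0 addr0.
  by rewrite mulr1.
elim/letterP: l dw {degw}; rewrite /ldeg /lpoly /= => dw.
(* [phi_edge] transfers the summand at [j] to the functional at [j - 2]; shifting the index by 2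
   then gives the rotated sum. *)
- pose h j := phi (j - 2) (wpoly j w * edge (j - 1)).
  transitivity (\sum_(j < 2 * p) h j%:Z).
    apply: eq_bigr => j _; have -> : j%:Z - 2 * 1 + 1 = j%:Z - 1 by lia.
    by rewrite /h [wpoly _ _ * _]mulrC phi_edge.
  rewrite -sum_shift2 => [|j]; last first.
    by rewrite /h wpolyD2p addrAC phi_per addrAC edgeD2p.
  apply: eq_bigr => j _; rewrite /h.
  by congr (phi _ (wpoly _ _ * edge _)); lia.
- pose h j := phi j (wpoly (j - 2) w).
  transitivity (\sum_(j < 2 * p) h j%:Z); last first.
    by apply: eq_bigr => j _; rewrite mulr1; congr (phi _ (wpoly _ _)); lia.
  rewrite -sum_shift2 => [|j]; last by rewrite /h addrAC wpolyD2p phi_per.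
  apply: eq_bigr => j _; rewrite /h mul1r addrK.
  (* The letter [F] contributes no factor, but [w] has degree 1 and must climb the edge above [j],
     so [phi_edge] still applies. *)
  have /dvdpP [g ->] : edge (j%:Z + 1) %| wpoly j w.
    have := @climb_dvd_wpoly j w 1; rewrite climbS /climb big_ord0 mul1r addr0.
    by apply; lia.
  have := phi_edge (j%:Z + 2) g; have -> : j%:Z + 2 - 1 = j%:Z + 1 by lia.
  by rewrite addrK mulrC.
- apply: eq_bigr => j _; rewrite mulr0 subr0; congr (phi _ _); apply: mulrC.
Qed.

Lemma wtrace_rot u w : wtrace (u ++ w) = wtrace (w ++ u).
Proof.
elim: u w => [|l u IH] w; first by rewrite cats0.
by rewrite /= wtrace_rot1 -catA IH -catA.
Qed.

(** In a closed path the [p] letters [E] contribute a full [turn], started at a weight of the parity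
    of [j]. *)
Lemma wtrace_Ep w : wtrace (nseq p letE ++ w) = 0.
Proof.
apply: big1 => j _; rewrite /loop wdeg_cat wdeg_nseq.
case: eqP => [degw|_]; last exact: phi0.
rewrite phi_turn_dvd // wpoly_cat wpoly_nseqE dvdp_mulr //.
rewrite -/(turn _) (@turn_congr _ _ _ p_gt1 q_prim _ j) ?dvdpp //.
by move: degw; rewrite /ldeg /=; lia.
Qed.

(** In a closed path [w] has degree [p], so [w] itself climbs a full [turn] from [j]. *)
Lemma wtrace_Fp w : wtrace (nseq p letF ++ w) = 0.
Proof.
apply: big1 => j _; rewrite /loop wdeg_cat wdeg_nseq.
case: eqP => [degw|_]; last exact: phi0.
rewrite phi_turn_dvd // wpoly_cat dvdp_mull //.
by apply: climb_dvd_wpoly; move: degw; rewrite /ldeg /=; lia.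
Qed.

Lemma wtrace_lin (c : k) u w :
  wdeg u = wdeg w -> (forall j, wpoly j u = c *: wpoly j w) ->
  wtrace u = c * wtrace w.
Proof.
move=> deguw uw; rewrite /wtrace mulr_sumr; apply: eq_bigr => j _.
by rewrite /loop deguw; case: eqP => _; rewrite ?uw ?phiZ ?phi0 ?mulr0.
Qed.

Lemma wtrace_K2p w : wtrace (nseq (2 * p) letK ++ w) = wtrace w.
Proof.
rewrite -[RHS]mul1r; apply: wtrace_lin => [|j].
  by rewrite wdeg_cat wdeg_nseq mul0r add0r.
by rewrite wpoly_cat wpoly_nseqK (qrootX2p q_prim) scale1r mul1r.
Qed.

Lemma wtrace_KE w :
  wtrace (letK :: letE :: nseq (2 * p - 1) letK ++ w)
    = q ^+ 2 * wtrace (letE :: w).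
Proof.
apply: wtrace_lin => [|j].
  by rewrite !wdeg_cons wdeg_cat wdeg_nseq mul0r !add0r.
rewrite /= wpoly_cat wpoly_nseqK !wdeg_cons !wdeg_cat !wdeg_nseq mul0r add0r.
rewrite (qrootX2pB1 p_gt1 q_prim) /lpoly /= /ldeg /=.
have qq : q ^ (j + 2 * (1 + wdeg w)) * q ^ (- (j + 2 * wdeg w)) = q ^+ 2.
  rewrite -expfzDr ?(qroot_neq0 q_prim) // -[RHS]/(q ^ 2%:Z).
  by congr (q ^ _); lia.
rewrite -qq -mul_polyC polyCM [edge _ * (_ * _)]mulrCA !mulrA.
by congr (_ * _ * edge _ * _); lia.
Qed.

Lemma wtrace_KF w :
  wtrace (letK :: letF :: nseq (2 * p - 1) letK ++ w)
    = q ^- 2 * wtrace (letF :: w).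
Proof.
apply: wtrace_lin => [|j].
  by rewrite !wdeg_cons wdeg_cat wdeg_nseq mul0r !add0r.
rewrite /= wpoly_cat wpoly_nseqK !wdeg_cons !wdeg_cat !wdeg_nseq mul0r add0r.
rewrite (qrootX2pB1 p_gt1 q_prim) /lpoly /= /ldeg /=.
have qq : q ^ (j + 2 * (-1 + wdeg w)) * q ^ (- (j + 2 * wdeg w)) = q ^- 2.
  rewrite -expfzDr ?(qroot_neq0 q_prim) // -[RHS]/(q ^ (- 2%:Z)).
  by congr (q ^ _); lia.
by rewrite -qq -mul_polyC polyCM !mul1r mulrA.
Qed.

(** The identity holds at each base weight: if [s] is the weight reached after [w], then
    [edge (s - 1) - edge (s + 1)] is the constant of [gam_step]. *)
Lemma wtrace_EF w :
  wtrace (letE :: letF :: w) - wtrace (letF :: letE :: w)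
    = (q - q^-1)^-1 * (wtrace (letK :: w) - wtrace (nseq (2 * p - 1) letK ++ w)).
Proof.
rewrite /wtrace -!sumrB mulr_sumr; apply: eq_bigr => j _.
rewrite /loop !wdeg_cons wdeg_cat wdeg_nseq /ldeg /= mul0r !add0r.
rewrite addrA subrr addrA addNr !add0r.
case: eqP => _; last by rewrite !phi0 subrr mulr0.
rewrite wpoly_cat wpoly_nseqK (qrootX2pB1 p_gt1 q_prim) /= /lpoly /= !wdeg_cons /ldeg /=.
set s := j%:Z + 2 * wdeg w; have -> : j%:Z + 2 * (-1 + wdeg w) = s - 2 by lia.
rewrite !mul1r -!phiB -!mulrBl -phiZ scalerAl.
congr (phi _ (_ * _)).
have -> : s - 2 + 1 = s - 1 by lia.
have -> : edge (s - 1) - edge (s + 1) = (gam q (s + 1) - gam q (s - 1))%:P.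
  by rewrite /edge polyCB; ring.
by rewrite -polyCB -mul_polyC -polyCM -(gam_step p_gt1 q_prim).
Qed.

End WeightPaths.

(** * An explicit family with prescribed coordinates *)

Section WeightFunctionals.
Variables (k : fieldType) (p : nat) (q : k).
Hypotheses (p_gt1 : (1 < p)%N) (q_prim : (2 * p).-primitive_root q).
Local Notation turn := (turn p q).
Local Notation edge := (edge q).
Local Notation gam := (gam q).

Variables (a : bool -> nat -> k) (c : nat -> k).

(** The arc of weights from the jump at [t] to the opposite jump at [2p - t]. It is empty for
    [t = 0], where an odd [c] has no jump. *)
Definition between (t : nat) (j : int) : bool :=
  [&& (0 < t)%N, t%:Z < (j %% (2 * p)%N)%Z, (j %% (2 * p)%N)%Z < (2 * p - t)%N%:Z
    & ~~ (2 %| j - t%:Z)%Z].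

(* The second sum solves [phi_j - phi_(j-2) = c_(j-1) ev_(gam (j-1))], for [c]
   odd, from [0] at [j = 0, 1]: the term of [c t] appears at [j = t + 1] and is
   cancelled by that of [c (2p - t) = - c t]. *)
Definition wfun (j : int) (f : {poly k}) : k :=
  \sum_(i < p) a (2 %| j)%Z i * (f %% turn j)`_i
  + \sum_(t < p) (if between t j then c t * f.[gam t%:Z] else 0).

Lemma between_lt2 t (j : int) : 0 <= j <= 1 -> between t j = false.
Proof.
move=> j01; rewrite /between modz_small; first by apply/negP; lia.
by lia.
Qed.

Lemma betweenD2p t j : between t (j + (2 * p)%N%:Z) = between t j.
Proof.
rewrite /between modzDr; congr [&& _, _, _ & ~~ _].
by apply/idP/idP; lia.
Qed.

(** The arc is entered or left only when [j - 1] is [t] or [- t] modulo [2p], and [gam] is even. *)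
Lemma between_shift t j : between t j != between t (j - 2) ->
  gam t%:Z = gam (j - 1).
Proof.
move=> neq.
have M0 : (2 * p)%N%:Z != 0 by lia.
have jE := divz_eq j (2 * p)%N; have r0 := modz_ge0 j M0.
have rlt := ltz_mod j M0.
have r'E : ((j - 2) %% (2 * p)%N)%Z = if 2 <= (j %% (2 * p)%N)%Z then
  (j %% (2 * p)%N)%Z - 2 else (j %% (2 * p)%N)%Z - 2 + (2 * p)%N%:Z.
  rewrite -modzDml; case: ifPn => ?; first by rewrite modz_small //; lia.
  by rewrite -modzDr modz_small //; lia.
move: neq; rewrite /between r'E; move: jE r0 rlt {r'E}.
set r := (j %% _)%Z; set d := (j %/ _)%Z => jE r0 rlt neq.
have par : (2 %| j - 2 - t%:Z)%Z = (2 %| j - t%:Z)%Z by apply/idP/idP; lia.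
(* The arc is entered at [r = t + 1] and left at [r = 2p + 1 - t], which for [t = 1] wraps around to
   [r = 0]. *)
have [tE|tE] : t%:Z = r - 1 \/ t%:Z = 1 - r + (2 * p)%N%:Z \/ t%:Z = 1 - r.
- have jE2 : j = 2 * (d * p%:Z) + r by rewrite {1}jE; lia.
  move: neq; rewrite par; move: (d * _) jE2 => dp jE2.
  have -> : (2 %| j - t%:Z)%Z = (2 %| r - t%:Z)%Z by apply/idP/idP; lia.
  case: (boolP (2 %| r - t%:Z)%Z) => rt; first by rewrite !andbF eqxx.
  rewrite /= !andbT; case: ifPn => r2 /eqP neq; first by lia.
  by lia.
- apply: (gam_modz p_gt1 q_prim); rewrite tE jE.
  by apply/dvdzP; exists (- d); lia.
- rewrite -(gamN _ (j - 1)); apply: (gam_modz p_gt1 q_prim); apply/dvdzP.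
  by case: tE => ->; rewrite jE; [exists (1 + d)|exists d]; lia.
Qed.

Lemma wfun_lin j b f g : wfun j (b *: f + g) = b * wfun j f + wfun j g.
Proof.
rewrite /wfun mulrDr addrACA; congr (_ + _); rewrite mulr_sumr -big_split /=.
  by apply: eq_bigr => i _; rewrite modpD modpZl coefD coefZ mulrDr mulrCA.
apply: eq_bigr => t _; case: ifP => _; last by rewrite mulr0 addr0.
by rewrite hornerD hornerZ mulrDr mulrCA.
Qed.

(** Weights of equal parity share the same [turn], so the remainder parts agree and only the arcs
    containing one of the two weights matter. *)
Lemma wfun_congr j j' f : (2 %| j - j')%Z ->
  (forall t : 'I_p, between t j != between t j' -> c t * f.[gam t%:Z] = 0) ->
  wfun j f = wfun j' f.
Proof.
move=> par eqt; rewrite /wfun (turn_congr p_gt1 q_prim par).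
have -> : (2 %| j)%Z = (2 %| j')%Z by apply/idP/idP; lia.
congr (_ + _); apply: eq_bigr => t _; move: (eqt t).
by case: between; case: between => //= ->.
Qed.

Lemma wfun_per j : wfun (j + (2 * p)%N%:Z) =1 wfun j.
Proof.
move=> f; apply: wfun_congr => [|t]; first by lia.
by rewrite betweenD2p eqxx.
Qed.

Lemma wfun_edge j g :
  wfun j (edge (j - 1) * g) = wfun (j - 2) (edge (j - 1) * g).
Proof.
apply: wfun_congr => [|t /between_shift ->]; first by lia.
by rewrite hornerM hornerXsubC subrr mul0r mulr0.
Qed.

(** The remainder is zero, and each arc through [j] has [t] of the opposite parity, where [turn j]
    has a root [gam t]. *)
Lemma wfun_turn j g : wfun j (turn j * g) = 0.
Proof.
rewrite /wfun mulrC modp_mull !big1 ?addr0 // => i _; last by rewrite coef0 mulr0.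
case: ifP => // /and4P[_ _ _ par].
by rewrite hornerM (turn_root p_gt1 q_prim par) !mulr0.
Qed.

Lemma wfun_family : weight_family p q wfun.
Proof.
by split; [exact: wfun_lin|exact: wfun_per|exact: wfun_edge|exact: wfun_turn].
Qed.

Lemma wfunXn (j : int) (i : 'I_p) : 0 <= j <= 1 -> wfun j 'X^i = a (2 %| j)%Z i.
Proof.
move=> j01; rewrite /wfun [X in _ + X]big1 => [|t _]; last by rewrite between_lt2.
rewrite addr0 modp_small; last by rewrite size_polyXn size_climb ltnS.
rewrite (bigD1 i) //= big1 ?addr0 => [|i' ne]; first by rewrite coefXn eqxx mulr1.
by rewrite coefXn -(inj_eq val_inj) in ne *; rewrite (negPf ne) mulr0.
Qed.

(** The arc of [s] contains [s + 1] but not [s - 1]; every other arc contains both or neither. *)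
Lemma wfun_jump (s : nat) : (0 < s < p)%N ->
  wfun (s%:Z + 1) 1 - wfun (s%:Z - 1) 1 = c s.
Proof.
move=> sp; have par : (2 %| s%:Z + 1 - (s%:Z - 1))%Z by lia.
rewrite /wfun (turn_congr p_gt1 q_prim par).
have -> : (2 %| s%:Z + 1)%Z = (2 %| s%:Z - 1)%Z by apply/idP/idP; lia.
rewrite opprD addrACA subrr add0r -sumrB.
have [s0 sltp] := andP sp.
rewrite (bigD1 (Ordinal sltp)) //= big1 => [|t ne]; rewrite ?hornerC.
  have -> : between s (s%:Z + 1) by rewrite /between modz_small; lia.
  have -> : between s (s%:Z - 1) = false by rewrite /between modz_small; lia.
  by rewrite mulr1 subr0 addr0.
have -> : between t (s%:Z + 1) = between t (s%:Z - 1); last by rewrite subrr.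
have {}ne : val t <> s by move=> ts; case/eqP: ne; apply/val_inj.
have := ltn_ord t; rewrite /between !modz_small /=; try by lia.
by move: ne; case: t => t /= _ ne ?; apply/idP/idP; lia.
Qed.

End WeightFunctionals.

(** * The relations of the restricted quantum group *)

Section RestrictedRelations.
Variables (k : fieldType) (p : nat) (q : k) (A : algType k) (E F K : A).

(** The projector [e_j], as a discrete Fourier transform of the powers of [K]. *)
Definition idem (j : int) : A :=
  (2 * p)%:R^-1 *: \sum_(m < 2 * p) q ^ (- (j * m%:Z)) *: K ^+ m.

Definition casimir : A :=
  F * E + ((q - q^-1) ^+ 2)^-1 *: (q *: K + q^-1 *: K ^+ (2 * p - 1)).

Lemma mul_idem x j : x * idem j =
  (2 * p)%:R^-1 *: \sum_(m < 2 * p) q ^ (- (j * m%:Z)) *: (x * K ^+ m).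
Proof.
rewrite -scalerAr mulr_sumr; congr (_ *: _).
by apply: eq_bigr => m _; rewrite scalerAr.
Qed.

Lemma mul_casimir x : x * casimir = x * (F * E)
  + ((q - q^-1) ^+ 2)^-1 *: (q *: (x * K) + q^-1 *: (x * K ^+ (2 * p - 1))).
Proof. by rewrite mulrDr -scalerAr mulrDr !scalerAr. Qed.

Hypotheses (p_gt1 : (1 < p)%N) (q_prim : (2 * p).-primitive_root q).
Hypotheses (relE : E ^+ p = 0) (relF : F ^+ p = 0) (relK : K ^+ (2 * p) = 1)
  (relKE : K * E * K ^+ (2 * p - 1) = q ^+ 2 *: E)
  (relKF : K * F * K ^+ (2 * p - 1) = q ^- 2 *: F)
  (relEF : E * F - F * E = (q - q^-1)^-1 *: (K - K ^+ (2 * p - 1))).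

Local Notation edge := (edge q).
Local Notation gam := (gam q).
Local Notation turn := (turn p q).

Lemma KinvK : K ^+ (2 * p - 1) * K = 1.
Proof. by rewrite -exprSr -[RHS]relK; congr (_ ^+ _); lia. Qed.

Lemma K_idem j : K * idem j = q ^ j *: idem j.
Proof.
rewrite /idem -scalerAr scalerA mulrC -scalerA; congr (_ *: _).
rewrite mulr_sumr scaler_sumr.
rewrite -[RHS](@sum_ord_shift _ _ (fun m => q ^ j *: (q ^ (- (j * m%:Z)) *: K ^+ m))).
  apply: eq_bigr => m _; rewrite -scalerAr -exprS scalerA.
  by rewrite -expfzDr ?(qroot_neq0 q_prim) //; congr (q ^ _ *: _); lia.
have -> : q ^ (- (j * (2 * p)%N%:Z)) = 1.
  by apply/eqP; rewrite (qroot_dvd q_prim) rpredN dvdz_mull.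
by rewrite relK mulr0.
Qed.

Lemma idem_K j : idem j * K = q ^ j *: idem j.
Proof.
rewrite -K_idem /idem -scalerAl -scalerAr mulr_suml mulr_sumr; congr (_ *: _).
by apply: eq_bigr => m _; rewrite -scalerAl -scalerAr -exprS -exprSr.
Qed.

Lemma Kinv_idem j : K ^+ (2 * p - 1) * idem j = q ^ (- j) *: idem j.
Proof.
have KX n : K ^+ n * idem j = (q ^ j) ^+ n *: idem j.
  elim: n => [|n IH]; first by rewrite mul1r scale1r.
  by rewrite exprSr -mulrA K_idem -scalerAr IH scalerA exprS.
by rewrite KX (qrootX2pB1 p_gt1 q_prim).
Qed.

Lemma sum_idem : \sum_(j < 2 * p) idem j%:Z = 1.
Proof.
rewrite /idem -scaler_sumr exchange_big /=.
have p0 : (0 < 2 * p)%N by lia.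
rewrite (bigD1 (Ordinal p0)) //= [X in _ + X]big1 ?addr0 => [|m m0].
  under eq_bigr do rewrite mulr0 oppr0 expr0z scale1r expr0.
  rewrite sumr_const card_ord -scaler_nat scalerA.
  by rewrite mulVf ?scale1r ?(natM_neq0 q_prim).
rewrite -scaler_suml.
under eq_bigr do rewrite mulrC -mulNr.
rewrite (qroot_sum q_prim); case: ifP => [|_]; last by rewrite scale0r.
have {}m0 : nat_of_ord m <> 0%N by move=> m_0; case/eqP: m0; apply/val_inj.
by rewrite rpredN => /dvdn_leq; have := ltn_ord m; lia.
Qed.

(** Identities may be checked weight by weight, since the projectors sum to 1. *)
Lemma idem_ext a b : (forall j, a * idem j = b * idem j) -> a = b.
Proof.
move=> ab; rewrite -[a]mulr1 -[b]mulr1 -sum_idem !mulr_sumr.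
by apply: eq_bigr => j _.
Qed.

Lemma shift_K (d : int) x : K * x = q ^ d *: (x * K) ->
  forall j, x * idem j = idem (j + d) * x.
Proof.
move=> Kx j; rewrite /idem -scalerAr -scalerAl mulr_sumr mulr_suml; congr (_ *: _).
apply: eq_bigr => m _; rewrite -scalerAr -scalerAl.
have -> : K ^+ m * x = (q ^ d) ^+ m *: (x * K ^+ m).
  elim: (nat_of_ord m) => [|n IH]; first by rewrite !expr0 scale1r mul1r mulr1.
  rewrite [K ^+ _]exprSr -mulrA Kx -scalerAr [K ^+ n * (_ * _)]mulrA IH.
  by rewrite -scalerAl scalerA -exprS -mulrA.
rewrite scalerA exprnP exprz_exp -expfzDr ?(qroot_neq0 q_prim) //.
by congr (q ^ _ *: _); lia.
Qed.

Lemma E_idem j : E * idem j = idem (j + 2) * E.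
Proof.
by apply: shift_K; rewrite -[K * E]mulr1 -KinvK mulrA relKE -scalerAl.
Qed.

Lemma F_idem j : F * idem j = idem (j - 2) * F.
Proof.
by apply: shift_K; rewrite -[K * F]mulr1 -KinvK mulrA relKF -scalerAl.
Qed.

Lemma EF_idem j :
  E * F * idem j = F * E * idem j + (gam (j + 1) - gam (j - 1)) *: idem j.
Proof.
have -> : E * F = F * E + (E * F - F * E) by rewrite addrC subrK.
rewrite relEF mulrDl -scalerAl mulrBl K_idem Kinv_idem -scalerBl scalerA.
by rewrite (gam_step p_gt1 q_prim).
Qed.

Lemma casimir_idem j : casimir * idem j = F * E * idem j + gam (j + 1) *: idem j.
Proof.
rewrite /casimir mulrDl -scalerAl mulrDl -!scalerAl K_idem Kinv_idem; congr (_ + _).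
rewrite !scalerA -scalerDl scalerA; congr (_ *: _).
rewrite /gam opprD !expfzDr ?(qroot_neq0 q_prim) //.
rewrite expr1z -[q ^ (-1)]/(q^-1); ring.
Qed.

Lemma casimir_idem' j : casimir * idem j = E * F * idem j + gam (j - 1) *: idem j.
Proof. by rewrite casimir_idem EF_idem -addrA -scalerDl subrK. Qed.

Lemma casimir_comm_idem j : GRing.comm casimir (idem j).
Proof.
have KX n : K ^+ n * idem j = idem j * K ^+ n.
  rewrite /idem -[LHS]scalerAr -[RHS]scalerAl mulr_suml mulr_sumr; congr (_ *: _).
  by apply: eq_bigr => m _; rewrite -scalerAl -scalerAr -!exprD addnC.
rewrite /GRing.comm /casimir mulrDl mulrDr -[X in _ + X]scalerAl.
rewrite -[X in _ = _ + X]scalerAr; congr (_ + _ *: _).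
  by rewrite -[LHS]mulrA E_idem [LHS]mulrA F_idem addrK mulrA.
rewrite mulrDl mulrDr -(scalerAl _ K) -(scalerAl _ (K ^+ _)).
rewrite -(scalerAr _ _ K) -(scalerAr _ _ (K ^+ _)) KX.
by congr (_ *: _ + _); apply: (KX 1).
Qed.

(** On [e_j] both sides become [E F E e_j + gam (j + 1) E e_j], by the [E F] form of the Casimir
    element at weight [j + 2] and the [F E] form at [j]. *)
Lemma casimir_comm_E : GRing.comm casimir E.
Proof.
apply: idem_ext => j; rewrite -[LHS]mulrA -[RHS]mulrA E_idem [LHS]mulrA
  casimir_idem' casimir_idem.
have -> : j + 2 - 1 = j + 1 by lia.
rewrite mulrDl mulrDr -(scalerAl _ _ E) -(scalerAr _ E) E_idem.
by congr (_ + _); rewrite -!mulrA E_idem.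
Qed.

Lemma casimir_comm_F : GRing.comm casimir F.
Proof.
apply: idem_ext => j; rewrite -[LHS]mulrA -[RHS]mulrA F_idem [LHS]mulrA
  casimir_idem casimir_idem'.
have -> : j - 2 + 1 = j - 1 by lia.
rewrite mulrDl mulrDr -(scalerAl _ _ F) -(scalerAr _ F) F_idem.
by congr (_ + _); rewrite -!mulrA F_idem.
Qed.

Local Notation hC := (horner_alg casimir).

Lemma hC_comm x g : GRing.comm casimir x -> x * hC g = hC g * x.
Proof.
move=> cx; elim/poly_ind: g => [|g b IH]; first by rewrite rmorph0 mulr0 mul0r.
rewrite rmorphD rmorphM /= horner_algX horner_algC mulrDr mulrDl mulrA IH.
by rewrite -[hC g * x * _]mulrA -cx mulrA mulr_algr mulr_algl.
Qed.

Lemma hC_edge j s : hC (edge s) * idem j = casimir * idem j - gam s *: idem j.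
Proof.
by rewrite /edge rmorphB /= horner_algX horner_algC mulrBl mulr_algl.
Qed.

Lemma FE_idem_edge j : F * E * idem j = hC (edge (j + 1)) * idem j.
Proof. by rewrite hC_edge casimir_idem addrK. Qed.

Lemma EF_idem_edge j : E * F * idem j = hC (edge (j - 1)) * idem j.
Proof. by rewrite hC_edge casimir_idem' addrK. Qed.

Lemma EX_idem n j : E ^+ n * idem j = idem (j + 2 * n%:Z) * E ^+ n.
Proof.
elim: n => [|n IH]; first by rewrite mulr0 addr0 mul1r mulr1.
rewrite exprS -mulrA IH mulrA E_idem mulrA; congr (idem _ * _ * _); lia.
Qed.

Lemma FX_idem n j : F ^+ n * idem j = idem (j - 2 * n%:Z) * F ^+ n.
Proof.
elim: n => [|n IH]; first by rewrite mulr0 subr0 mul1r mulr1.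
rewrite exprS -mulrA IH mulrA F_idem mulrA; congr (idem _ * _ * _); lia.
Qed.

Lemma hC_idem j g : idem j * hC g = hC g * idem j.
Proof. exact/hC_comm/casimir_comm_idem. Qed.

Lemma hC_EX n g : E ^+ n * hC g = hC g * E ^+ n.
Proof. exact/hC_comm/commrX/casimir_comm_E. Qed.

Lemma hC_FX n g : F ^+ n * hC g = hC g * F ^+ n.
Proof. exact/hC_comm/commrX/casimir_comm_F. Qed.

(** Together with [lowered], these are weight vectors whose left multiples by [E], [F] and [K] are
    again of this form up to scalars. *)
Definition raised n g j : A := E ^+ n * hC g * idem j.
Definition lowered n g j : A := F ^+ n * hC g * idem j.

Lemma raisedE n g j : raised n g j = idem (j + 2 * n%:Z) * E ^+ n * hC g.
Proof. by rewrite /raised -mulrA -hC_idem mulrA EX_idem. Qed.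

Lemma loweredE n g j : lowered n g j = idem (j - 2 * n%:Z) * F ^+ n * hC g.
Proof. by rewrite /lowered -mulrA -hC_idem mulrA FX_idem. Qed.

Lemma E_raised n g j : E * raised n g j = raised n.+1 g j.
Proof. by rewrite /raised !mulrA -exprS. Qed.

Lemma F_lowered n g j : F * lowered n g j = lowered n.+1 g j.
Proof. by rewrite /lowered !mulrA -exprS. Qed.

Lemma F_raised n g j :
  F * raised n.+1 g j = raised n (edge (j + 2 * n%:Z + 1) * g) j.
Proof.
rewrite -E_raised !raisedE !mulrA FE_idem_edge rmorphM [RHS]mulrA.
congr (_ * hC g); rewrite -[RHS]mulrA hC_EX [RHS]mulrA; congr (_ * _).
exact/esym/hC_idem.
Qed.

Lemma E_lowered n g j :
  E * lowered n.+1 g j = lowered n (edge (j - 2 * n%:Z - 1) * g) j.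
Proof.
rewrite -F_lowered !loweredE !mulrA EF_idem_edge rmorphM [RHS]mulrA.
congr (_ * hC g); rewrite -[RHS]mulrA hC_FX [RHS]mulrA; congr (_ * _).
exact/esym/hC_idem.
Qed.

Lemma K_raised n g j : K * raised n g j = q ^ (j + 2 * n%:Z) *: raised n g j.
Proof. by rewrite raisedE !mulrA K_idem -!scalerAl. Qed.

Lemma K_lowered n g j : K * lowered n g j = q ^ (j - 2 * n%:Z) *: lowered n g j.
Proof. by rewrite loweredE !mulrA K_idem -!scalerAl. Qed.

Lemma raised_K n g j : raised n g j * K = q ^ j *: raised n g j.
Proof. by rewrite /raised -[LHS]mulrA idem_K -scalerAr. Qed.

Lemma lowered_K n g j : lowered n g j * K = q ^ j *: lowered n g j.
Proof. by rewrite /lowered -[LHS]mulrA idem_K -scalerAr. Qed.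

(** Each [F] cancels one [E] and leaves the factor of the edge crossed; at [n = p] the product is
    [turn j]. *)
Lemma climb_idem n g j : F ^+ n * raised n g j = hC (climb q j n * g) * idem j.
Proof.
elim: n g => [|n IH] g; first by rewrite /raised /climb big_ord0 !mul1r.
by rewrite exprSr -[LHS]mulrA F_raised IH climbS mulrA.
Qed.

(** * Symmetric functions on weight vectors *)

Variable phi : A -> k^o.
Hypotheses (phi_lin : linear phi) (phi_sym : forall a b, phi (a * b) = phi (b * a)).

HB.instance Definition _ := GRing.isLinear.Build k A k^o *:%R phi phi_lin.

(** The edge condition is cyclicity: [E (F e_j)] and [(F e_j) E = F E e_(j-2)] have the same value.
    The turn condition is [climb_idem] together with [F ^+ p = 0]. *)
Lemma slf_family : weight_family p q (fun j g => phi (hC g * idem j)).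
Proof.
split=> [j b f g|j g|j g|j g].
- rewrite -mul_polyC rmorphD rmorphM /= horner_algC mulrDl -mulrA mulr_algl.
  exact: phi_lin.
- congr (phi (_ * _)); rewrite /idem; congr (_ *: _); apply: eq_bigr => m _.
  by rewrite -!mulNr -!exprz_exp -!invr_expz (qrootD2p q_prim).
- have -> : hC (edge (j - 1) * g) = hC g * hC (edge (j - 1)).
    by rewrite mulrC rmorphM.
  rewrite -[_ * _ * idem j]mulrA -EF_idem_edge.
  have -> : j - 1 = j - 2 + 1 by lia.
  rewrite -[_ * _ * idem (j - 2)]mulrA -FE_idem_edge.
  have -> : E * F * idem j = E * (F * idem j) by rewrite mulrA.
  have -> : F * E * idem (j - 2) = F * idem j * E.
    by rewrite -[LHS]mulrA E_idem subrK mulrA.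
  rewrite !mulrA [in RHS]phi_sym !mulrA; congr (phi (_ * _ * _)).
  exact/esym/hC_comm/casimir_comm_E.
- by rewrite -climb_idem relF mul0r linear0.
Qed.

(** For [0 < n < p] the left and right eigenvalues of [K] differ by the factor [q ^ (2n)], which is
    not 1, so symmetry forces the value [0]. The case [n = 0] is the assumption, and [E ^+ p = 0]
    settles the rest. *)
Lemma slf_raised0 n g j : (forall j g, phi (hC g * idem j) = 0) ->
  phi (raised n g j) = 0.
Proof.
move=> phi0; have [le_pn|lt_np] := leqP p n.
  by rewrite /raised -(subnK le_pn) exprD relE mulr0 !mul0r linear0.
case: n lt_np => [|n] lt_np; first by rewrite /raised mul1r.
have := phi_sym K (raised n.+1 g j); rewrite K_raised raised_K !linearZ /=.
move/eqP; rewrite -subr_eq0 -scalerBl scaler_eq0 => /orP [|/eqP //].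
rewrite expfzDr ?(qroot_neq0 q_prim) // -{2}[q ^ j]mulr1 -mulrBr mulf_eq0.
rewrite (negPf (expfz_neq0 _ (qroot_neq0 q_prim))) subr_eq0 (qroot_dvd q_prim) /=.
by rewrite -PoszM dvdzE => /dvdn_leq; lia.
Qed.

Lemma slf_lowered0 n g j : (forall j g, phi (hC g * idem j) = 0) ->
  phi (lowered n g j) = 0.
Proof.
move=> phi0; have [le_pn|lt_np] := leqP p n.
  by rewrite /lowered -(subnK le_pn) exprD relF mulr0 !mul0r linear0.
case: n lt_np => [|n] lt_np; first by rewrite /lowered mul1r.
have := phi_sym K (lowered n.+1 g j); rewrite K_lowered lowered_K !linearZ /=.
move/eqP; rewrite -subr_eq0 -scalerBl scaler_eq0 => /orP [|/eqP //].
rewrite expfzDr ?(qroot_neq0 q_prim) // -{2}[q ^ j]mulr1 -mulrBr mulf_eq0.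
rewrite (negPf (expfz_neq0 _ (qroot_neq0 q_prim))) subr_eq0 (qroot_dvd q_prim) /=.
by rewrite rpredN -PoszM dvdzE => /dvdn_leq; lia.
Qed.

Definition letter_val (l : 'I_3) : A :=
  if val l is 0%N then E else if val l is 1%N then F else K.

Definition word_val (w : seq 'I_3) : A := \prod_(l <- w) letter_val l.

Lemma slf_word0 : (forall j g, phi (hC g * idem j) = 0) ->
  forall w, phi (word_val w) = 0.
Proof.
move=> phi0 w.
(* Both families are carried together: they coincide at [n = 0], where [E] and [F] pass from one to
   the other. *)
have phiw : forall n g j, phi (word_val w * raised n g j) = 0 /\
    phi (word_val w * lowered n g j) = 0.
  elim/last_ind: w => [|w l IH] n g j.
    rewrite /word_val big_nil !mul1r.
    by split; [apply: slf_raised0|apply: slf_lowered0].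
  rewrite /word_val -cats1 big_cat big_seq1 /= -/(word_val w) -!mulrA.
  case: l => [[|[|l]] lt_l]; rewrite /letter_val /=.
  - rewrite E_raised; split; first by case: (IH n.+1 g j).
    case: n => [|n]; last first.
      by rewrite E_lowered; case: (IH n (edge (j - 2 * n%:Z - 1) * g) j).
    by rewrite -[lowered 0 g j]/(raised 0 g j) E_raised; case: (IH 1%N g j).
  - rewrite F_lowered; split; last by case: (IH n.+1 g j).
    case: n => [|n]; last first.
      by rewrite F_raised; case: (IH n (edge (j + 2 * n%:Z + 1) * g) j).
    by rewrite -[raised 0 g j]/(lowered 0 g j) F_lowered; case: (IH 1%N g j).
  - have [r0 l0] := IH n g j.
    by rewrite K_raised K_lowered -!scalerAr !linearZ /= r0 l0 !scaler0.
rewrite -[word_val w]mulr1 -sum_idem mulr_sumr linear_sum big1 // => j _.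
by have [+ _] := phiw 0%N 1 j; rewrite /raised rmorph1 expr0 !mul1r.
Qed.

Lemma slf_eq0 :
  (forall i, (i < p)%N -> phi (casimir ^+ i * idem 0) = 0) ->
  (forall i, (i < p)%N -> phi (casimir ^+ i * idem 1) = 0) ->
  (forall s : nat, (0 < s < p)%N ->
    phi (idem (s%:Z + 1) - idem (s%:Z - 1)) = 0) ->
  forall w, phi (word_val w) = 0.
Proof.
have hCX i : hC 'X^i = casimir ^+ i by rewrite rmorphXn /= horner_algX.
move=> phi0 phi1 phis; apply: slf_word0.
apply: (weight_family_eq0 p_gt1 q_prim slf_family) => [i|i|s] lt_p.
- by rewrite hCX phi0.
- by rewrite hCX phi1.
- by apply/eqP; rewrite -subr_eq0 rmorph1 !mul1r -linearB /= phis.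
Qed.

End RestrictedRelations.

(** * Symmetric functions from families *)

Section WordTrace.
Variables (k : fieldType) (p : nat) (q : k) (A : algType k) (E F K : A).
Hypotheses (p_gt1 : (1 < p)%N) (q_prim : (2 * p).-primitive_root q).
Local Notation edge := (edge q).
Local Notation word := (word_val E F K).
Local Notation cas := (casimir p q E F K).

(** Of the free algebra only this is kept: words span it, and [loop] extends linearly to a map
    [floop]. *)
Hypothesis word_ind : forall P : A -> Prop,
  P 0 -> (forall c w x, P x -> P (c *: word w + x)) -> forall x, P x.
Variable floop : int -> A -> {poly k}.
Hypothesis floop_lin :
  forall s c x y, floop s (c *: x + y) = c *: floop s x + floop s y.
Hypothesis floop_word : forall s w, floop s (word w) = loop q s w.

Lemma word_nil : word [::] = 1.
Proof. exact: big_nil. Qed.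

Lemma word_cat u w : word (u ++ w) = word u * word w.
Proof. exact: big_cat. Qed.

Lemma word_cons l w : word (l :: w) = letter_val E F K l * word w.
Proof. exact: big_cons. Qed.

Lemma word1 l : word [:: l] = letter_val E F K l.
Proof. exact: big_seq1. Qed.

Lemma word_mulE w : E * word w = word (0 :: w).
Proof. by rewrite word_cons. Qed.

Lemma word_mulF w : F * word w = word (1 :: w).
Proof. by rewrite word_cons. Qed.

Lemma word_mulK w : K * word w = word (2 :: w).
Proof. by rewrite word_cons. Qed.

Lemma wordX l n : word (nseq n l) = letter_val E F K l ^+ n.
Proof.
elim: n => [|n IH]; first exact: word_nil.
by rewrite exprS -IH -word_cons.
Qed.

Lemma floop0 s : floop s 0 = 0.
Proof. by have := floop_lin s (-1) 0 0; rewrite scaler0 addr0 scaleN1r addNr. Qed.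

Lemma floopZ s c x : floop s (c *: x) = c *: floop s x.
Proof. by rewrite -[c *: x]addr0 floop_lin floop0 addr0. Qed.

Lemma floopD s x y : floop s (x + y) = floop s x + floop s y.
Proof. by rewrite -[x]scale1r floop_lin !scale1r. Qed.

Lemma floop_sum s I (r : seq I) (G : I -> A) :
  floop s (\sum_(i <- r) G i) = \sum_(i <- r) floop s (G i).
Proof. exact: (big_morph _ (floopD s) (floop0 s)). Qed.

Lemma floop1 s : floop s 1 = 1.
Proof. by rewrite -word_nil floop_word /loop wdeg_nil. Qed.

Lemma floop_mulK s x : floop s (x * K) = q ^ s *: floop s x.
Proof.
elim/word_ind: x => [|c w x IH]; first by rewrite mul0r floop0 scaler0.
rewrite mulrDl -scalerAl !floop_lin IH scalerDr !scalerA [_ * c]mulrC -scalerA.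
congr (_ *: _ + _).
rewrite [_ * K](_ : _ = word (w ++ [:: 2])); last by rewrite word_cat word1.
by rewrite !floop_word loop_catK mulrC mul_polyC.
Qed.

Lemma floop_mulKX s x n : floop s (x * K ^+ n) = (q ^ s) ^+ n *: floop s x.
Proof.
elim: n => [|n IH]; first by rewrite !expr0 mulr1 scale1r.
by rewrite exprSr mulrA floop_mulK IH scalerA exprS.
Qed.

Lemma floop_mulFE s x : floop s (x * (F * E)) = floop s x * edge (s + 1).
Proof.
elim/word_ind: x => [|c w x IH]; first by rewrite mul0r floop0 mul0r.
rewrite mulrDl -scalerAl !floop_lin IH mulrDl -scalerAl; congr (_ *: _ + _).
rewrite [_ * (F * E)](_ : _ = word (w ++ [:: 1; 0])); last first.
  by rewrite word_cat word_cons word1.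
by rewrite !floop_word loop_catFE.
Qed.

(** [F E] contributes ['X - gam (s + 1)] and the part in [K] restores [gam (s + 1)]. *)
Lemma floop_mulC s x : floop s (x * cas) = floop s x * 'X.
Proof.
rewrite mul_casimir floopD floop_mulFE floopZ floopD !floopZ floop_mulKX.
rewrite floop_mulK (qrootX2pB1 p_gt1 q_prim).
have -> : (q - q^-1) ^- 2 *:
    (q *: (q ^ s *: floop s x) + q^-1 *: (q ^ (- s) *: floop s x))
    = gam q (s + 1) *: floop s x.
  rewrite !scalerA -scalerDl scalerA /gam opprD !expfzDr ?(qroot_neq0 q_prim) //.
  by rewrite expr1z -[q ^ (-1)]/(q^-1); congr (_ *: _); ring.
by rewrite /edge mulrBr [floop s x * _%:P]mulrC mul_polyC subrK.
Qed.

(** Fourier orthogonality: a projector selects the paths based at its own weight. *)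
Lemma floop_mul_idem s x j : floop s (x * idem p q K j) =
  if ((2 * p)%N%:Z %| s - j)%Z then floop s x else 0.
Proof.
rewrite mul_idem floopZ floop_sum.
rewrite (eq_bigr (fun m : 'I_(2 * p) => q ^ ((s - j) * m%:Z) *: floop s x)).
  rewrite -scaler_suml (qroot_sum q_prim); case: ifP => _.
    by rewrite scalerA mulVf ?scale1r ?(natM_neq0 q_prim).
  by rewrite scale0r scaler0.
move=> m _; rewrite floopZ floop_mulKX scalerA exprnP exprz_exp.
by rewrite -expfzDr ?(qroot_neq0 q_prim) //; congr (q ^ _ *: _); lia.
Qed.

Variable phi : int -> {poly k} -> k.
Hypothesis phiP : weight_family p q phi.

Definition ftrace (x : A) : k := \sum_(j < 2 * p) phi j%:Z (floop j%:Z x).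

Lemma ftrace_lin c x y : ftrace (c *: x + y) = c * ftrace x + ftrace y.
Proof.
rewrite /ftrace mulr_sumr -big_split; apply: eq_bigr => j _.
by rewrite floop_lin (weight_family_lin phiP).
Qed.

Lemma ftrace0 : ftrace 0 = 0.
Proof. by apply: big1 => j _; rewrite floop0 (weight_family0 phiP). Qed.

Lemma ftraceZ c x : ftrace (c *: x) = c * ftrace x.
Proof. by rewrite -[c *: x]addr0 ftrace_lin ftrace0 addr0. Qed.

Lemma ftraceD x y : ftrace (x + y) = ftrace x + ftrace y.
Proof. by rewrite -[x]scale1r ftrace_lin mul1r scale1r. Qed.

Lemma ftraceB x y : ftrace (x - y) = ftrace x - ftrace y.
Proof. by rewrite addrC -scaleN1r ftrace_lin mulN1r addrC. Qed.

Lemma ftrace_word w : ftrace (word w) = wtrace p q phi w.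
Proof. by apply: eq_bigr => j _; rewrite floop_word. Qed.

Lemma ftrace_sym x y : ftrace (x * y) = ftrace (y * x).
Proof.
elim/word_ind: x y => [|c u x IH] y; first by rewrite mul0r mulr0.
rewrite mulrDl mulrDr -scalerAl -scalerAr !ftrace_lin IH; congr (_ * _ + _).
elim/word_ind: y {IH} => [|d w y IHy]; first by rewrite mul0r mulr0.
rewrite mulrDl mulrDr -scalerAl -scalerAr !ftrace_lin IHy; congr (_ * _ + _).
by rewrite -!word_cat !ftrace_word (wtrace_rot p_gt1 q_prim phiP).
Qed.

Lemma ftrace_mul_word0 x :
  (forall w, ftrace (x * word w) = 0) -> forall y, ftrace (x * y) = 0.
Proof.
move=> x0; elim/word_ind => [|c w y IH]; first by rewrite mulr0 ftrace0.
by rewrite mulrDr -scalerAr ftrace_lin x0 IH mulr0 addr0.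
Qed.

Lemma ftrace_Ep y : ftrace (E ^+ p * y) = 0.
Proof.
apply: ftrace_mul_word0 y => w.
have -> : E ^+ p * word w = word (nseq p 0 ++ w) by rewrite word_cat wordX.
by rewrite ftrace_word (wtrace_Ep p_gt1 q_prim phiP).
Qed.

Lemma ftrace_Fp y : ftrace (F ^+ p * y) = 0.
Proof.
apply: ftrace_mul_word0 y => w.
have -> : F ^+ p * word w = word (nseq p 1 ++ w) by rewrite word_cat wordX.
by rewrite ftrace_word (wtrace_Fp p_gt1 q_prim phiP).
Qed.

Lemma wordKX n w : K ^+ n * word w = word (nseq n 2 ++ w).
Proof. by rewrite word_cat wordX. Qed.

Lemma ftrace_K2p y : ftrace ((K ^+ (2 * p) - 1) * y) = 0.
Proof.
apply: ftrace_mul_word0 y => w.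
by rewrite mulrBl mul1r wordKX ftraceB !ftrace_word (wtrace_K2p q_prim phiP) subrr.
Qed.

Lemma ftrace_KE y :
  ftrace ((K * E * K ^+ (2 * p - 1) - q ^+ 2 *: E) * y) = 0.
Proof.
apply: ftrace_mul_word0 y => w.
rewrite mulrBl -scalerAl -!mulrA wordKX !word_mulE word_mulK ftraceB ftraceZ.
rewrite !ftrace_word.
by rewrite (wtrace_KE p_gt1 q_prim phiP) subrr.
Qed.

Lemma ftrace_KF y :
  ftrace ((K * F * K ^+ (2 * p - 1) - q ^- 2 *: F) * y) = 0.
Proof.
apply: ftrace_mul_word0 y => w.
rewrite mulrBl -scalerAl -!mulrA wordKX !word_mulF word_mulK ftraceB ftraceZ.
rewrite !ftrace_word.
by rewrite (wtrace_KF p_gt1 q_prim phiP) subrr.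
Qed.

Lemma ftrace_EF y : ftrace ((E * F - F * E
  - (q - q^-1)^-1 *: (K - K ^+ (2 * p - 1))) * y) = 0.
Proof.
apply: ftrace_mul_word0 y => w.
rewrite !mulrBl -scalerAl mulrBl wordKX -!mulrA.
rewrite !(word_mulE, word_mulF, word_mulK).
by rewrite !(ftraceB, ftraceZ) !ftrace_word (wtrace_EF p_gt1 q_prim phiP) subrr.
Qed.

(** The trace recovers the family it was built from, so prescribed coordinates are attained. *)
Lemma ftrace_casimir_idem i (n : nat) : (n < 2 * p)%N ->
  ftrace (cas ^+ i * idem p q K n%:Z) = phi n%:Z 'X^i.
Proof.
move=> lt_n; rewrite /ftrace.
have floopC s : floop s (cas ^+ i) = 'X^i.
  elim: i => [|i IH]; first by rewrite !expr0 floop1.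
  by rewrite !exprSr floop_mulC IH.
under eq_bigr do rewrite floop_mul_idem floopC.
rewrite (bigD1 (Ordinal lt_n)) //= subrr dvdz0 big1 ?addr0 // => j ne.
case: ifP => [/dvdzP [d]|_]; last exact: weight_family0 phiP _.
have {}ne : nat_of_ord j <> n by move=> eq_j; case/eqP: ne; apply/val_inj.
have := ltn_ord j; have [->|[d1|d1]] : d = 0 \/ d <= -1 \/ 1 <= d by lia.
- by lia.
- by nia.
- by nia.
Qed.

End WordTrace.

(** * Coordinates of a symmetric linear function *)

Section SlfCoordinates.
Variables (k : fieldType) (p : nat) (q : k) (A : algType k) (E F K : A).
Hypotheses (p_gt1 : (1 < p)%N) (q_prim : (2 * p).-primitive_root q).
Hypotheses (relE : E ^+ p = 0) (relF : F ^+ p = 0) (relK : K ^+ (2 * p) = 1)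
  (relKE : K * E * K ^+ (2 * p - 1) = q ^+ 2 *: E)
  (relKF : K * F * K ^+ (2 * p - 1) = q ^- 2 *: F)
  (relEF : E * F - F * E = (q - q^-1)^-1 *: (K - K ^+ (2 * p - 1))).
Local Notation cas := (casimir p q E F K).
Local Notation idem := (idem p q K).

Hypothesis word_span : forall phi : A -> k^o, linear phi ->
  (forall w, phi (word_val E F K w) = 0) -> forall x, phi x = 0.
Hypothesis slf_of_family : forall phi : int -> {poly k} -> k,
  weight_family p q phi -> exists psi : slf A, forall i (n : nat),
    (n < 2 * p)%N -> psi (cas ^+ i * idem n%:Z) = phi n%:Z 'X^i.

(** Blocks of lengths [p], [p] and [p - 1]: the functional at weight 0, the one at weight 1, and the
    jumps at [s = m - 2p + 1], which runs from 1 to [p - 1]. *)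
Definition coord_elt (m : nat) : A :=
  if (m < p)%N then cas ^+ m * idem 0
  else if (m < 2 * p)%N then cas ^+ (m - p) * idem 1
  else idem ((m - 2 * p).+1%:Z + 1) - idem ((m - 2 * p).+1%:Z - 1).

Definition slf_coord (phi : slf A) : 'rV[k]_(3 * p - 1) :=
  \row_m phi (coord_elt m).

Lemma slf_coord_linear : linear slf_coord.
Proof. by move=> c f g; apply/rowP => m; rewrite !mxE. Qed.

Lemma slf_linear (phi : slf A) : linear (phi : A -> k^o).
Proof. by have /asboolP[] := slfP phi. Qed.

Lemma slf_symmetric (phi : slf A) a b : phi (a * b) = phi (b * a).
Proof. by have /asboolP[_] := slfP phi. Qed.

Lemma slf_coord_inj : injective slf_coord.
Proof.
move=> f g fg; apply/val_inj/funext => x /=.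
pose h : slf A := f - g.
have h0 m : (m < 3 * p - 1)%N -> h (coord_elt m) = 0.
  move=> lt_m; have := congr1 (fun v : 'rV_(3 * p - 1) => v 0 (Ordinal lt_m)) fg.
  by rewrite !mxE /= => fgm; apply/eqP; rewrite subr_eq0; apply/eqP.
suff hx : h x = 0 by apply/eqP; rewrite -subr_eq0; apply/eqP.
apply: word_span => [|w]; first exact: slf_linear.
apply: (slf_eq0 p_gt1 q_prim relE relF relK relKE relKF relEF
  (slf_linear h) (slf_symmetric h)) => [i lt_i|i lt_i|s sp].
- have := h0 i; rewrite /coord_elt lt_i; apply; lia.
- have <- : coord_elt (p + i) = cas ^+ i * idem 1.
    by rewrite /coord_elt addKn ifF ?ifT //; lia.
  by apply: h0; lia.
- have <- : coord_elt (2 * p + s.-1) = idem (s%:Z + 1) - idem (s%:Z - 1).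
    rewrite /coord_elt addKn prednK; last by lia.
    by rewrite !ifF //; lia.
  by apply: h0; lia.
Qed.

Lemma slf_coord_surj (v : 'rV[k]_(3 * p - 1)) : exists phi, slf_coord phi = v.
Proof.
(* The vector is extended by 0 to all natural numbers, to avoid bounds in the index arithmetic. *)
pose vn m : k := if insub m is Some m' then v 0 m' else 0.
pose a (b : bool) i := if b then vn i else vn (p + i)%N.
(* The third block starts at index [2p] with [s = 1], whence the predecessor. *)
pose c s := vn (2 * p + s.-1)%N.
have [psi psiE] := slf_of_family (wfun_family p_gt1 q_prim a c).
exists psi; apply/rowP => m; rewrite mxE /coord_elt.
have vm : v 0 m = vn m by rewrite /vn valK.
rewrite vm; case: ifPn => [lt_mp|ge_mp].
  rewrite psiE; last by lia.
  by rewrite (@wfunXn _ _ q p_gt1 q_prim a c 0 (Ordinal lt_mp)).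
case: ifPn => [lt_m2p|ge_m2p].
  have lt_mp : (m - p < p)%N by lia.
  rewrite psiE; last by lia.
  by rewrite (@wfunXn _ _ q p_gt1 q_prim a c 1 (Ordinal lt_mp)) //= /a; congr vn; lia.
have lt_m := ltn_ord m.
set s := (m - 2 * p).+1; have sp : (0 < s < p)%N by rewrite /s; lia.
have psiB x y : psi (x - y) = psi x - psi y.
  by rewrite addrC -scaleN1r (slf_linear psi) scaleN1r addrC.
have idemE (n : nat) : (n < 2 * p)%N -> psi (idem n%:Z) = wfun p q a c n%:Z 1.
  by move=> lt_n; rewrite -[idem _]mul1r; apply: (psiE 0%N).
have s1 : s%:Z + 1 = s.+1%:Z by lia.
have s2 : s%:Z - 1 = s.-1%:Z by lia.
rewrite psiB s1 s2 !idemE; try lia.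
by rewrite -s1 -s2 wfun_jump // /c; congr vn; rewrite /s; lia.
Qed.

Lemma slf_coord_bij : bijective slf_coord.
Proof.
pose inv v := projT1 (cid (slf_coord_surj v)).
have invK : cancel inv slf_coord.
  by move=> v; apply: (projT2 (cid (slf_coord_surj v))).
by exists inv => // phi; apply: slf_coord_inj; rewrite invK.
Qed.

End SlfCoordinates.

(** * The free algebra and its quotient *)

Section QuotientMap.
Variables (C : comNzRingType) (A : algType C) (I : twoSidedIdeal A).
Local Notation Q := (alg_quot I).

Definition quot_pi (x : A) : Q := (\pi_Q x)%qT.

Lemma quot_piM x y : quot_pi (x * y) = quot_pi x * quot_pi y.
Proof. exact: pi_quot_mul. Qed.

Lemma quot_piZ c x : quot_pi (c *: x) = c *: quot_pi x.
Proof. exact: pi_quot_scale. Qed.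

Lemma quot_pi1 : quot_pi 1 = 1.
Proof. exact: pi_quot_one. Qed.

Lemma quot_piD x y : quot_pi (x + y) = quot_pi x + quot_pi y.
Proof. exact: pi_addr. Qed.

Lemma quot_pi_linear : linear quot_pi.
Proof. by move=> c x y; rewrite quot_piD quot_piZ. Qed.

Lemma quot_pi_monoid : monoid_morphism quot_pi.
Proof. by split; [exact: quot_pi1|exact: quot_piM]. Qed.

HB.instance Definition _ := GRing.isLinear.Build C A Q *:%R quot_pi quot_pi_linear.
HB.instance Definition _ := GRing.isMonoidMorphism.Build A Q quot_pi quot_pi_monoid.

Lemma quot_pi_eq0 x : x \in (I : {pred A}) -> quot_pi x = 0.
Proof.
by move=> xI; apply/eqP; rewrite -[0](linear0 quot_pi) /quot_pi pi_quot_eq subr0.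
Qed.

Lemma quot_piK (y : Q) : quot_pi (repr y) = y.
Proof. exact: reprK. Qed.

(** Evaluation at a representative is well defined because [phi] vanishes on the ideal. *)
Lemma slf_descend (phi : A -> C^o) : linear phi ->
  (forall x y, phi (x * y) = phi (y * x)) ->
  (forall x, x \in (I : {pred A}) -> phi x = 0) ->
  exists psi : slf Q, forall x, psi (quot_pi x) = phi x.
Proof.
move=> phi_lin phi_sym phiI.
pose psi (y : Q) : C^o := phi (repr y).
have psiE x : psi (quot_pi x) = phi x.
  have := phi_lin (-1) x (repr (quot_pi x)).
  rewrite scaleN1r [- x + _]addrC phiI; last exact: repr_pi_sub.
  by move=> /esym/eqP; rewrite scaleN1r addrC subr_eq0 => /eqP.
have psiP : psi \in (symmetric_linear (A := Q) : {pred Q -> C^o}).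
  apply/asboolP; split=> [c x y|x y].
    rewrite -[x]quot_piK -[y]quot_piK -quot_pi_linear !psiE.
    exact: phi_lin.
  by rewrite -[x]quot_piK -[y]quot_piK -!quot_piM !psiE.
by exists (Slf psiP).
Qed.

End QuotientMap.

Inductive quantum_rel (k : fieldType) (p : nat) (q : k) (A : algType k)
    (E F K : A) : A -> Prop :=
| QRelE : quantum_rel p q E F K (E ^+ p)
| QRelF : quantum_rel p q E F K (F ^+ p)
| QRelK : quantum_rel p q E F K (K ^+ (2 * p) - 1)
| QRelKE : quantum_rel p q E F K (K * E * K ^+ (2 * p - 1) - q ^+ 2 *: E)
| QRelKF : quantum_rel p q E F K (K * F * K ^+ (2 * p - 1) - q ^- 2 *: F)
| QRelEF : quantum_rel p q E F K
    (E * F - F * E - (q - q^-1)^-1 *: (K - K ^+ (2 * p - 1))).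

(** * Dimension count for an algebra presented by the quantum relations *)

Section PresentedQuotient.
Variables (k : fieldType) (p : nat) (q : k) (A : algType k) (E F K : A).
Hypotheses (p_gt1 : (1 < p)%N) (q_prim : (2 * p).-primitive_root q).
Local Notation word := (word_val E F K).

Hypothesis word_ind : forall P : A -> Prop,
  P 0 -> (forall c w x, P x -> P (c *: word w + x)) -> forall x, P x.
Variable floop : int -> A -> {poly k}.
Hypothesis floop_lin :
  forall s c x y, floop s (c *: x + y) = c *: floop s x + floop s y.
Hypothesis floop_word : forall s w, floop s (word w) = loop q s w.

Variables (S : A -> Prop) (I : twoSidedIdeal A).
Hypotheses (S_rel : forall r, S r -> quantum_rel p q E F K r)
  (rel_S : forall r, quantum_rel p q E F K r -> S r)
  (S_I : forall r, S r -> r \in (I : {pred A}))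
  (I_span : forall x, x \in (I : {pred A}) -> ideal_span S x).

Lemma ftrace_ideal phi x : weight_family p q phi -> x \in (I : {pred A}) ->
  ftrace p floop phi x = 0.
Proof.
move=> phiP /I_span Sx.
have sym := ftrace_sym p_gt1 q_prim word_ind floop_lin floop_word phiP.
(* The unit is generalized to an arbitrary right factor [y]; left multiples in the ideal are rotated
   to the right by [sym]. *)
rewrite -[x]mulr1; move: 1; elim: {x} Sx => [r /S_rel rel y|y
  |x1 x2 _ IH1 _ IH2 y|b x _ IH y|b x _ IH y].
- case: rel.
  + exact: (ftrace_Ep p_gt1 q_prim word_ind floop_lin floop_word phiP).
  + exact: (ftrace_Fp p_gt1 q_prim word_ind floop_lin floop_word phiP).
  + exact: (ftrace_K2p q_prim word_ind floop_lin floop_word phiP).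
  + exact: (ftrace_KE p_gt1 q_prim word_ind floop_lin floop_word phiP).
  + exact: (ftrace_KF p_gt1 q_prim word_ind floop_lin floop_word phiP).
  + exact: (ftrace_EF p_gt1 q_prim word_ind floop_lin floop_word phiP).
- by rewrite mul0r (ftrace0 floop_lin phiP).
- by rewrite mulrDl (ftraceD floop_lin phiP) IH1 IH2 addr0.
- by rewrite -mulrA sym -mulrA IH.
- by rewrite -mulrA IH.
Qed.

Local Notation Q := (alg_quot I).
Local Notation qpi := (@quot_pi k A I).

Lemma quot_rel r : quantum_rel p q E F K r -> qpi r = 0.
Proof. by move=> /rel_S /S_I /quot_pi_eq0. Qed.

Lemma quot_pi_idem j : qpi (idem p q K j) = idem p q (qpi K) j.
Proof.
rewrite /idem linearZ linear_sum; congr (_ *: _); apply: eq_bigr => m _.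
by rewrite linearZ rmorphXn.
Qed.

Lemma quot_pi_casimir :
  qpi (casimir p q E F K) = casimir p q (qpi E) (qpi F) (qpi K).
Proof.
by rewrite /casimir linearD rmorphM linearZ linearD !linearZ rmorphXn.
Qed.

Lemma quot_pi_word w : qpi (word w) = word_val (qpi E) (qpi F) (qpi K) w.
Proof.
rewrite /word_val rmorph_prod; apply: eq_bigr => l _.
by rewrite /letter_val; case: (val l) => [|[|m]].
Qed.

(** Injectivity of the coordinates comes from the relations in the quotient, surjectivity from
    [ftrace], which kills the ideal and descends. *)
Theorem slf_quot_dim :
  exists2 f : slf Q -> 'rV[k]_(3 * p - 1), linear f & bijective f.
Proof.
exists (slf_coord p q (qpi E) (qpi F) (qpi K)); first exact: slf_coord_linear.
have rel0 x y : quantum_rel p q E F K (x - y) -> qpi x = qpi y.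
  by move=> /quot_rel; rewrite linearB => /eqP; rewrite subr_eq0 => /eqP.
apply: (slf_coord_bij p_gt1 q_prim).
- by rewrite -rmorphXn; apply: quot_rel; constructor.
- by rewrite -rmorphXn; apply: quot_rel; constructor.
- by rewrite -rmorphXn -(rmorph1 qpi); apply: rel0; constructor.
- by rewrite -rmorphXn -!rmorphM -linearZ; apply: rel0; constructor.
- by rewrite -rmorphXn -!rmorphM -linearZ; apply: rel0; constructor.
- by rewrite -rmorphXn -!rmorphM -!linearB -linearZ; apply: rel0; constructor.
- move=> phi phi_lin phiw x; rewrite -[x]quot_piK.
  elim/word_ind: (repr x) => [|c w y IH].
    rewrite linear0; have := phi_lin (-1) 0 0.
    by rewrite scaler0 addr0 scaleN1r addNr.
  by rewrite quot_pi_linear phi_lin quot_pi_word phiw IH scaler0 addr0.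
- move=> phi phiP.
  have [psi psiE] : exists psi : slf Q, forall x, psi (qpi x) = ftrace p floop phi x.
    apply: slf_descend => [c x y|x y|x xI].
    + exact: (ftrace_lin floop_lin phiP).
    + exact: (ftrace_sym p_gt1 q_prim word_ind floop_lin floop_word phiP).
    + exact: ftrace_ideal.
  exists psi => i n lt_n; rewrite -quot_pi_casimir -quot_pi_idem -rmorphXn -rmorphM
    psiE.
  exact: (ftrace_casimir_idem p_gt1 q_prim word_ind floop_lin floop_word phiP).
Qed.

End PresentedQuotient.

Lemma malgU_scale (k : comNzRingType) (M : monomType) (c : k) (m : M) :
  << c *g m >> = c *: << m >> :> {malg k[M]}.
Proof.
apply/malgP => m'; rewrite mcoeffZ !mcoeffU.
by case: eqP => _; rewrite ?mulr0n ?mulr1n ?mulr1 ?mulr0.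
Qed.

Lemma mmap_polyC_scale (k : comNzRingType) (M : choiceType) (h : M -> {poly k})
    (c : k) (x : {malg k[M]}) :
  mmap (@polyC k) h (c *: x) = c *: mmap (@polyC k) h x.
Proof.
rewrite (mmapEw (msuppZ_le _ _)) mmapE scaler_sumr; apply: eq_bigr => m _.
by rewrite mcoeffZ /= polyCM -mulrA mul_polyC.
Qed.

Section FreeWords.
Variable k : comNzRingType.
Local Notation FA := (free_alg3 k).

Definition fword (w : seq 'I_3) : FA := << FMonom w >>.

Lemma fword_nil : fword [::] = 1.
Proof. by rewrite /fword -fmoneE. Qed.

Lemma fword_cat u w : fword (u ++ w) = fword u * fword w.
Proof.
have := fgmulUU (1 : k) 1 (FMonom u) (FMonom w); rewrite mulr1 => mulUU.
by apply: etrans (esym mulUU); rewrite /fword -(fmmulE (FMonom u) (FMonom w)).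
Qed.

Lemma fword_ind (P : FA -> Prop) :
  P 0 -> (forall c w x, P x -> P (c *: fword w + x)) -> forall x, P x.
Proof.
move=> P0 PD x; rewrite (monalgE x); elim: (enum_fset (msupp x)) => [|m s IH].
  by rewrite big_nil.
by rewrite big_cons malgU_scale -[m]fmK; apply: PD.
Qed.

End FreeWords.


Section FreeAlgebraLoops.
Variables (k : fieldType) (q : k).
Local Notation FA := (free_alg3 k).

Lemma word_val_fword w :
  word_val (fword k [:: 0]) (fword k [:: 1]) (fword k [:: 2]) w = fword k w.
Proof.
elim: w => [|l w IH]; first by rewrite word_nil fword_nil.
rewrite word_cons IH -[l :: w]cat1s fword_cat; congr (_ * _).
by elim/letterP: l.
Qed.

Lemma free_word_ind (P : FA -> Prop) : P 0 ->
  (forall c w x, P x ->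
    P (c *: word_val (fword k [:: 0]) (fword k [:: 1]) (fword k [:: 2]) w + x)) ->
  forall x, P x.
Proof.
move=> P0 PD; apply: fword_ind => [|c w x]; first exact: P0.
by rewrite -word_val_fword; apply: PD.
Qed.

Definition free_loop (s : int) (x : FA) : {poly k} :=
  mmap (@polyC k) (fun m : {fmonom 'I_3} => loop q s (fmonom_val m)) x.

Lemma free_loop_linear s c x y :
  free_loop s (c *: x + y) = c *: free_loop s x + free_loop s y.
Proof.
apply: etrans (mmapD _ _) _; congr (_ + _); exact: mmap_polyC_scale.
Qed.

Lemma free_loop_fword s w : free_loop s (fword k w) = loop q s w.
Proof. by rewrite /free_loop mmapU mul1r. Qed.

Lemma free_loop_word s w : free_loop s
  (word_val (fword k [:: 0]) (fword k [:: 1]) (fword k [:: 2]) w) = loop q s w.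
Proof. by rewrite word_val_fword free_loop_fword. Qed.

End FreeAlgebraLoops.

Theorem theorem4p6 (R : realType) (p : nat) (hp : (2 <= p)%N) :
  exists2 f : slf (restricted_Uq R hp) -> 'rV[R[i]]_(3 * p - 1)%N,
    linear f & bijective f.
Proof.
have q_prim := uq_q_prim R (ltnW hp).
have letterE l : letter R l = fword R[i] [:: l] by rewrite /letter fmuE.
apply: (@slf_quot_dim _ p (uq_q R p) _
  (fword R[i] [:: 0]) (fword R[i] [:: 1]) (fword R[i] [:: 2]) hp q_prim _
  (free_loop (uq_q R p)) _ _ (@uq_relator R p)).
- exact: free_word_ind.
- exact: free_loop_linear.
- exact: free_loop_word.
- move=> r; rewrite -!letterE; case.
  + exact: QRelE.
  + exact: QRelF.
  + exact: QRelK.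
  + exact: QRelKE.
  + exact: QRelKF.
  + exact: QRelEF.
- move=> r; rewrite -!letterE; case.
  + exact: RelEp.
  + exact: RelFp.
  + exact: RelK2p.
  + exact: RelKE.
  + exact: RelKF.
  + exact: RelEF.
- by move=> r rel; apply/asboolP/IdealSpanGen.
- by move=> x /asboolP.
Qed.
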